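(* Let $1<p<\infty$. If $A\in(l_p(r,s,t;B),l_1)$, then $$\lim_{m\to\infty}\Big(\sup_{F\in\mathcal{F}_m}\Big(\sum_{k=0}^\infty\Big|\sum_{n\in F}\tilde a_{nk}\Big|^{p'}\Big)^{1/p'}\Big)\le\|L_A\|_\chi\le4\lim_{m\to\infty}\Big(\sup_{F\in\mathcal{F}_m}\Big(\sum_{k=0}^\infty\Big|\sum_{n\in F}\tilde a_{nk}\Big|^{p'}\Big)^{1/p'}\Big),$$ and $L_A$ is compact if and only if $$\lim_{m\to\infty}\Big(\sup_{F\in\mathcal{F}_m}\Big(\sum_{k=0}^\infty\Big|\sum_{n\in F}\tilde a_{nk}\Big|^{p'}\Big)^{1/p'}\Big)=0.$$
   Context: Sequences are indexed by $\mathbb{N}_0=\{0,1,2,\dots\}$; $\mathbb{N}=\{1,2,\dots\}$; $w$ is the space of all real or complex sequences. For $m\in\mathbb{N}$, $\mathcal{F}_m$ is the collection of nonempty finite subsets $F$ of $\mathbb{N}$ with $n>m$ for all $n\in F$. $r=(r_n)$, $t=(t_n)$, $s=(s_n)$ are sequences in $w$ with $r_n\ne0$, $t_n\neq 0$ for all $n$, and $s_0\neq0$; $u,v$ are nonzero scalars. $A(r,s,t)$ is the lower triangular infinite matrix with entries $s_{n-k}t_k/r_n$ for $0\le k\le n$ and $0$ for $k>n$; $B=B(u,v)=(b_{nk})$ has $b_{nn}=u$, $b_{n,n-1}=v$ and all other entries $0$. For real $p\ge1$, $l_p(r,s,t;B)=\{x\in w:(A(r,s,t)\cdot B)x\in l_p\}$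 with norm $\|x\|=\|(A(r,s,t)\cdot B)x\|_{l_p}$ (a $BK$ space, i.e. a Banach sequence space with continuous coordinates). $p'=p/(p-1)$. $D^{(s)}_0=1/s_0$ and, for $n\ge1$, $D^{(s)}_n=s_0^{-(n+1)}\det(d_{ij})_{1\le i,j\le n}$ with $d_{ij}=s_{i-j+1}$ if $j\le i+1$ and $d_{ij}=0$ if $j>i+1$. For sequence spaces $U,V$, $(U,V)$ is the class of infinite matrices $A=(a_{nk})$ such that for all $x\in U$ the series $(Ax)_n=\sum_ka_{nk}x_k$ converge and $Ax\in V$. $L_A$ is the operator $L_A(x)=Ax$ (bounded when $U,V$ are $BK$ spaces with $U$ containing all finite sequences). For a matrix $A=(a_{nk})$, $$\tilde a_{nk}=r_k\Big[\frac{a_{nk}}{s_0t_k}\frac1u+\sum_{i=k}^{k+1}(-1)^{i-k}\frac{D^{(s)}_{i-k}}{t_i}\Big(\sum_{j=k+1}^\infty\frac{(-v)^{j-i}}{u^{j-i+1}}a_{nj}\Big)+\sum_{i=k+2}^\infty(-1)^{i-k}\frac{D^{(s)}_{i-k}}{t_i}\Big(\sum_{j=i}^\infty\frac{(-v)^{j-i}}{u^{j-i+1}}a_{nj}\Big)\Big],$$ provided the series converge. The Hausdorff measure of noncompactness of a bounded subset $Q$ of a metric space $X$ is $\chi(Q)=\inf\{\epsilon>0: Q\subset\bigcup_{i=0}^nB(x_i,r_i),\ x_i\in X,\ r_i<\epsilon,\ n\in\mathbb{N}_0\}$, where $B(x_i,r_i)$ are open balls. For a bounded operator $L:X\to Y$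 between Banach spaces, $\|L\|_\chi=\chi(L(S_X))$ with $S_X$ the unit sphere of $X$.
   Formalization: ''Provided the series converge'' is taken to include, for all n and k, convergence (in Pringsheim's sense) of the double series over k+2 ≤ i ≤ j in the definition of ã_{nk}; with convergence of the iterated series alone the claim is false. *)

(* Defs.v *)
From mathcomp Require Import all_boot all_order all_algebra.
From mathcomp Require Import all_classical all_reals all_analysis.
From mathcomp Require Import finmap complex.

Set Implicit Arguments.
Unset Strict Implicit.
Unset Printing Implicit Defensive.

Import Order.TTheory GRing.Theory Num.Theory.
Import numFieldNormedType.Exports.

Local Open Scope classical_set_scope.
Local Open Scope ring_scope.

(* Sequences and matrices have all their entries in [R], or all in [R[i]]. *)
Inductive scalar_kind := real_scalars | complex_scalars.

Definition scalar_field (R : realType) (b : scalar_kind) : numFieldType :=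
  match b with
  | real_scalars => R
  | complex_scalars => R[i]
  end.

(* The norm of [scalar_field R b] takes its values in [scalar_field R b]; the
   modulus below takes them in [R]. *)
Definition modulus (R : realType) (b : scalar_kind) : scalar_field R b -> R :=
  match b return scalar_field R b -> R with
  | real_scalars => fun x : R => `|x|
  | complex_scalars => fun x : R[i] => Normc.normc x
  end.

Local Notation "\sum_ ( m <= i <oo ) F" :=
  (\big[+%R/0%R]_(m <= i <oo) F%R) : ring_scope.

Section SequenceSpaces.
Variables (R : realType) (b : scalar_kind).
Local Notation K := (scalar_field R b).
Local Notation sequence := (nat -> K).
Local Notation matrix := (nat -> nat -> K).

(* Only the values of [snorm] on [carrier] matter. *)
Record seq_space := SeqSpace {
  carrier : set sequence;
  snorm : sequence -> \bar R }.

Definition lp_norm (p : R) (x : sequence) : \bar R :=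
  ((\sum_(0 <= k <oo) ((modulus (x k)) `^ p)%:E) `^ p^-1)%E.

Definition lp (p : R) : seq_space :=
  SeqSpace
    [set x | (\sum_(0 <= k <oo) ((modulus (x k)) `^ p)%:E < +oo)%E]
    (lp_norm p).

Definition unit_sphere (X : seq_space) : set sequence :=
  [set x | carrier X x /\ snorm X x = 1%E].

Definition open_ball (X : seq_space) (c : sequence) (rho : R) : set sequence :=
  [set x | carrier X x /\ (snorm X (fun k => (x k - c k)%R) < rho%:E)%E].

(* The value is +oo exactly when [Q] is unbounded. *)
Definition chi (X : seq_space) (Q : set sequence) : \bar R :=
  ereal_inf [set eps%:E | eps in
    [set eps : R | 0 < eps /\
      exists (n : nat) (c : 'I_n.+1 -> sequence) (rho : 'I_n.+1 -> R),
        [/\ forall i, carrier X (c i),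
            forall i, rho i < eps &
            Q `<=` \bigcup_(i in [set: 'I_n.+1]) open_ball X (c i) (rho i)]]].

Definition chi_norm (X Y : seq_space) (L : sequence -> sequence) : \bar R :=
  chi Y (L @` unit_sphere X).

Definition compact_operator (X Y : seq_space) (L : sequence -> sequence) :=
  forall x : nat -> sequence,
    (forall i, carrier X (x i)) ->
    (exists M : R, forall i, (snorm X (x i) <= M%:E)%E) ->
    exists phi : nat -> nat, {homo phi : i j / (i < j)%N} /\
    exists y : sequence, carrier Y y /\
      (fun i => snorm Y (fun k => (L (x (phi i)) k - y k)%R)) @ \oo --> 0%E.

Definition matrix_transform (A : matrix) (x : sequence) : sequence :=
  fun n => \sum_(0 <= k <oo) A n k * x k.

Definition matrix_product (A B : matrix) : matrix :=
  fun n k => \sum_(0 <= i <oo) A n i * B i k.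

Definition matrix_class (X Y : seq_space) (A : matrix) : Prop :=
  forall x, carrier X x ->
    (forall n, cvgn (fun N => \sum_(0 <= k < N) A n k * x k)) /\
    carrier Y (matrix_transform A x).

Definition matrix_domain (X : seq_space) (T : matrix) : seq_space :=
  SeqSpace [set x | carrier X (matrix_transform T x)]
           (fun x => snorm X (matrix_transform T x)).

Definition mxA (r s t : sequence) : matrix :=
  fun n k => if (k <= n)%N then s (n - k)%N * t k / r n else 0.

Definition mxB (u v : K) : matrix :=
  fun n k => if k == n then u else if k.+1 == n then v else 0.

Definition lp_rstB (p : R) (r s t : sequence) (u v : K) : seq_space :=
  matrix_domain (lp p) (matrix_product (mxA r s t) (mxB u v)).

(* Rows and columns are numbered from 0 here; the index i - j + 1 only depends
   on the difference. *)
Definition dets (s : sequence) (n : nat) : K :=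
  if n == 0%N then (s 0%N)^-1 else
  s 0%N ^- n.+1 *
  \det (\matrix_(i < n, j < n) if (j <= i.+1)%N then s (i.+1 - j)%N else 0).

Definition inner_term (u v : K) (A : matrix) (n i j : nat) : K :=
  (- v) ^+ (j - i) / u ^+ (j - i).+1 * A n j.

Definition outer_coef (s t : sequence) (k i : nat) : K :=
  (- 1) ^+ (i - k) * dets s (i - k) / t i.

Definition tilde (r s t : sequence) (u v : K) (A : matrix) : matrix :=
  fun n k =>
    r k * (A n k / (s 0%N * t k) / u
      + \sum_(k <= i < k.+2)
          outer_coef s t k i * (\sum_(k.+1 <= j <oo) inner_term u v A n i j)
      + \sum_(k.+2 <= i <oo)
          outer_coef s t k i * (\sum_(i <= j <oo) inner_term u v A n i j)).

(* The series defining the entry (n, k) of [tilde] converge.  The last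
   condition is convergence, in Pringsheim's sense (limit of the rectangular
   partial sums when both bounds tend to infinity independently), of the double
   series over k + 2 <= i <= j.  Convergence of the iterated series alone does
   not allow the two summations to be exchanged, and then [tilde] need not
   represent the operator of [A]. *)
Definition tilde_series_converge (s t : sequence) (u v : K) (A : matrix)
    (n k : nat) : Prop :=
  [/\ forall i, (k <= i < k.+2)%N ->
        cvgn (fun J => \sum_(k.+1 <= j < J) inner_term u v A n i j),
      forall i, (k.+2 <= i)%N ->
        cvgn (fun J => \sum_(i <= j < J) inner_term u v A n i j),
      cvgn (fun I => \sum_(k.+2 <= i < I)
        outer_coef s t k i * (\sum_(i <= j <oo) inner_term u v A n i j)) &
      cvg ((fun IJ : nat * nat => \sum_(k.+2 <= i < IJ.1)
        outer_coef s t k i * (\sum_(i <= j < IJ.2) inner_term u v A n i j))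
        @ (\oo, \oo))].

Definition finite_sets_above (m : nat) : set {fset nat} :=
  [set F | F != fset0 /\ forall n, n \in F -> (m < n)%N].

Definition section_sup (q : R) (At : matrix) (m : nat) : \bar R :=
  ereal_sup [set lp_norm q (fun k => (\sum_(n <- F) At n k)%R)
            | F in finite_sets_above m].

End SequenceSpaces.

(* Main.v *)
Require Import Defs.
From mathcomp Require Import all_boot all_order all_algebra.
From mathcomp Require Import all_classical all_reals all_analysis.
From mathcomp Require Import finmap complex.
From mathcomp Require Import lra ring zify.

(** Let T = A(r,s,t) B.  It is lower triangular with nonzero diagonal, so it
    has a lower triangular inverse S, and y |-> S y is an isometry of l_p onto
    l_p(r,s,t;B).  The theorem is therefore about the operator y |-> A (S y)
    from l_p to l_1.

    Entries.  By Cramer's rule (-1)^n D_n is the entry (n,0) of the inverse of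
    the Toeplitz matrix of s ([conv_inverse_unique]), and the inverse of B is
    an explicit geometric matrix; this gives S ([preimageK]).  Pringsheim
    convergence allows the double series in the definition of tilde a_nk to be
    summed along squares, where it is a partial sum of sum_j a_nj S_jk: thus
    tilde a_nk is the entry (n,k) of A S ([tilde_is_limit]).

    Rows.  The functional y |-> (A S y)_n is a pointwise limit on l_p of
    functionals with finite support.  A gliding hump shows that these are
    uniformly bounded ([uniform_bound]); so the functional is bounded, and it
    is the pairing with the n-th row of tilde A ([row_bounded],
    [row_representation]).

    Bounds.  Write ell for the limit in the theorem.  By Hoelder's inequality,
    which is attained at finitely supported vectors ([extremal_vector]), the
    norm in l_p' of the sum of the rows with index in F is the norm of
    y |-> sum_(n in F) (A S y)_n.  If finitely many balls of radius eps cover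
    the image of the sphere, then beyond some m all the centres have small
    tails, so these sums are at most eps plus a small error for F in F_m:
    this is the lower bound ([lim_section_sup_le_chi]).  Conversely
    sum |z_n| <= 4 max_F |sum_(n in F) z_n| ([sum_modulus_le4]), so on the
    sphere the tails of A S y are eventually below 4 ell up to a small error,
    while the heads stay in a box, which has finite nets: this is the upper
    bound ([chi_le_lim_section_sup]).

    Compactness.  If ell = 0 the tails are uniformly small on bounded sets.
    The coordinates of A S y_i converge along an ultrafilter finer than the
    filter of cofinite sets, the small tails turn this into closeness in l_1,
    and a subsequence can be chosen ([lim_section_sup0_compact]).  If
    ell > 0, there are y_m on the sphere such that the tail of A S y_m beyond m
    stays above a fixed e > 0, which no l_1-convergent subsequence permits
    ([compact_lim_section_sup0]). *)

Set Implicit Arguments.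
Unset Strict Implicit.
Unset Printing Implicit Defensive.

Import Order.TTheory GRing.Theory Num.Theory.
Import numFieldNormedType.Exports.
Local Open Scope classical_set_scope.
Local Open Scope ring_scope.

(** * The two scalar fields through one real modulus *)

Section Modulus.
Variables (R : realType) (b : scalar_kind).
Local Notation K := (scalar_field R b).
Implicit Types x y z : K.

Definition of_real : R -> K :=
  match b return (R -> scalar_field R b) with
  | real_scalars => fun x : R => x
  | complex_scalars => fun x : R => real_complex R x
  end.

Lemma of_realD (c d : R) : of_real (c + d) = of_real c + of_real d.
Proof. by rewrite /of_real; case: b => //; rewrite rmorphD. Qed.

Lemma of_realM (c d : R) : of_real (c * d) = of_real c * of_real d.
Proof. by rewrite /of_real; case: b => //; rewrite rmorphM. Qed.

Lemma of_real0 : of_real 0 = 0.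
Proof. by rewrite /of_real; case: b. Qed.

Lemma modulus_of_real (c : R) : 0 <= c -> modulus (of_real c) = c.
Proof.
rewrite /of_real /modulus; case: b => c0; first by rewrite ger0_norm.
by rewrite /= expr0n /= addr0 sqrtr_sqr ger0_norm.
Qed.

Lemma normE x : `|x| = of_real (modulus x).
Proof. by rewrite /of_real /modulus; case: b x => // -[]. Qed.

Lemma of_real_lt (c d : R) : (of_real c < of_real d) = (c < d).
Proof. by rewrite /of_real; case: b => //; rewrite ltcR. Qed.

Lemma gt0_of_real (e : K) : 0 < e -> exists2 c : R, 0 < c & e = of_real c.
Proof.
move=> e0; exists (modulus e); last by rewrite -normE gtr0_norm.
by rewrite -of_real_lt -normE of_real0 normr_gt0 gt_eqF.
Qed.

Lemma modulus_ge0 x : 0 <= modulus x.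
Proof.
by rewrite /modulus; case: b x => [x|[c d]]; rewrite ?normr_ge0 //= sqrtr_ge0.
Qed.
Hint Resolve modulus_ge0 : core.

Lemma modulusM x y : modulus (x * y) = modulus x * modulus y.
Proof.
by rewrite /modulus; case: b x y => [x y|x y]; rewrite ?normrM // Normc.normcM.
Qed.

Lemma modulusD x y : modulus (x + y) <= modulus x + modulus y.
Proof.
by rewrite /modulus; case: b x y => [x y|x y]; rewrite ?ler_normD // le_normcD.
Qed.

Lemma modulusN x : modulus (- x) = modulus x.
Proof. by rewrite /modulus; case: b x => [x|x]; rewrite ?normrN // normcN. Qed.

Lemma modulusBC x y : modulus (x - y) = modulus (y - x).
Proof. by rewrite -modulusN opprB. Qed.

Lemma modulus0 : modulus (0 : K) = 0.
Proof. by rewrite -of_real0 modulus_of_real. Qed.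

Lemma modulus_eq0 x : modulus x = 0 -> x = 0.
Proof. by move=> x0; apply/eqP; rewrite -normr_eq0 normE x0 of_real0. Qed.

Lemma modulus_sum (I : Type) (S : seq I) (P : pred I) (f : I -> K) :
  modulus (\sum_(i <- S | P i) f i) <= \sum_(i <- S | P i) modulus (f i).
Proof.
elim/big_rec2: _ => [|i c x _ xc]; first by rewrite modulus0.
by apply: le_trans (modulusD _ _) _; rewrite lerD2l.
Qed.

(** Replaces conjugation: it lets Hoelder's inequality be attained over both
    scalar fields with the same formula. *)
Lemma phase x : exists2 w : K, modulus w = 1 & x * w = of_real (modulus x).
Proof.
have m1 : modulus (1 : K) = 1.
  suff <- : of_real 1 = 1 by rewrite modulus_of_real.
  by rewrite /of_real; case: b => //; rewrite rmorph1.
have [->|x0] := eqVneq x 0; first by exists 1; rewrite // mul0r modulus0 of_real0.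
have mx0 : modulus x != 0 by apply/eqP => /modulus_eq0; apply/eqP.
exists (`|x| / x); last by rewrite mulrC divfK // normE.
apply: (mulIf mx0); rewrite -modulusM divfK // normE modulus_of_real //.
by rewrite mul1r.
Qed.

(** The only bridge used between limits in K, whose norm is K-valued, and
    estimates in R. *)
Lemma cvg_modulusP (T : Type) (F : set_system T) (FF : Filter F) (f : T -> K) x :
  f @ F --> x <-> forall e : R, 0 < e -> \forall n \near F, modulus (f n - x) < e.
Proof.
split=> [/cvgrPdist_lt + e e0|h]; last apply/cvgrPdist_lt => e /gt0_of_real[c c0 ->].
  move=> /(_ (of_real e)); rewrite -[0]of_real0 of_real_lt => /(_ e0).
  by apply: filterS => n; rewrite normE of_real_lt modulusBC.
by apply: filterS (h _ c0) => n; rewrite normE of_real_lt modulusBC.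
Qed.

Lemma cvg_modulus_le (f : nat -> K) x (c : R) :
  f @ \oo --> x -> (exists N, forall n, (N <= n)%N -> modulus (f n) <= c) ->
  modulus x <= c.
Proof.
move=> /cvg_modulusP fx [N fc]; apply/ler_addgt0Pr => e /fx[N' _ h].
have := h (maxn N N') (leq_maxr _ _); rewrite /= => h1.
have := modulusD (f (maxn N N')) (x - f (maxn N N')).
rewrite addrC subrK modulusBC => /le_trans; apply; apply: lerD; last exact: ltW.
by apply: fc; rewrite leq_maxl.
Qed.

Lemma cvg_modulus_bounded (f : nat -> K) :
  cvgn f -> exists c : R, forall n, modulus (f n) <= c.
Proof.
move=> /cvg_ex[x /cvg_modulusP/(_ 1 ltr01)[N _ h]].
exists (\sum_(i < N) modulus (f i) + (modulus x + 1)) => n.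
have x1 : 0 <= modulus x + 1 by rewrite addr_ge0.
have [nN|Nn] := ltnP n N.
  rewrite -[leLHS]addr0; apply: lerD => //.
  by rewrite (bigD1 (Ordinal nN)) //= lerDl sumr_ge0.
rewrite -[leLHS]add0r; apply: lerD; first by rewrite sumr_ge0.
have := modulusD x (f n - x); rewrite addrC subrK => /le_trans; apply.
by rewrite lerD2l; apply/ltW/h.
Qed.

(** Split the sum into its terms of each sign. *)
Lemma sum_norm_le2 (a : nat -> R) (S : seq nat) (c : R) :
  (forall P : pred nat, `|\sum_(n <- S | P n) a n| <= c) ->
  \sum_(n <- S) `|a n| <= 2 * c.
Proof.
move=> h; rewrite (bigID (fun n => 0 <= a n)) /= mulr2n mulrDl mul1r.
apply: lerD.
  rewrite (eq_bigr a) => [|i ai]; last by rewrite ger0_norm.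
  exact: le_trans (ler_norm _) (h _).
rewrite (eq_bigr (fun i => - a i)) => [|i ai]; last by rewrite ltr0_norm // ltNge.
rewrite sumrN; apply: le_trans (h (fun n => ~~ (0 <= a n))).
by rewrite -normrN; exact: ler_norm.
Qed.

Definition re_part : K -> R :=
  match b return (scalar_field R b -> R) with
  | real_scalars => fun x : R => x
  | complex_scalars => fun x : R[i] => complex.Re x
  end.

Definition im_part : K -> R :=
  match b return (scalar_field R b -> R) with
  | real_scalars => fun=> 0
  | complex_scalars => fun x : R[i] => complex.Im x
  end.

(** For real scalars the second coordinate is discarded; as the imaginary part
    is then 0, the estimates below hold for both fields. *)
Definition of_parts : R -> R -> K :=
  match b return (R -> R -> scalar_field R b) with
  | real_scalars => fun c _ : R => c
  | complex_scalars => fun c d : R => Complex c d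
  end.

Lemma re_partD x y : re_part (x + y) = re_part x + re_part y.
Proof. by rewrite /re_part; case: b x y => //= -[? ?] [? ?]. Qed.

Lemma im_partD x y : im_part (x + y) = im_part x + im_part y.
Proof.
by rewrite /im_part; case: b x y => [x y|]; [rewrite addr0|move=> -[? ?] [? ?]].
Qed.

Lemma re_part0 : re_part 0 = 0.
Proof. by rewrite /re_part; case: b. Qed.

Lemma im_part0 : im_part 0 = 0.
Proof. by rewrite /im_part; case: b. Qed.

Lemma re_part_le x : `|re_part x| <= modulus x.
Proof.
rewrite /re_part /modulus; case: b x => //= -[c d] /=.
by rewrite -sqrtr_sqr ler_wsqrtr // lerDl sqr_ge0.
Qed.

Lemma im_part_le x : `|im_part x| <= modulus x.
Proof.
rewrite /im_part /modulus; case: b x => /= [x|[c d] /=]; first by rewrite normr0.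
by rewrite -sqrtr_sqr ler_wsqrtr // lerDr sqr_ge0.
Qed.

Lemma modulus_le_parts x (c d : R) :
  modulus (x - of_parts c d) <= `|re_part x - c| + `|im_part x - d|.
Proof.
rewrite /re_part /im_part /of_parts /modulus.
case: b x => [x|[x y]] /=; first by rewrite lerDl.
rewrite -[leRHS]ger0_norm ?addr_ge0 // -sqrtr_sqr ler_wsqrtr //.
rewrite [leRHS]sqrrD !real_normK ?num_real //.
by rewrite addrAC lerDl mulrn_wge0 // mulr_ge0.
Qed.

(** The constant 4 of the theorem: a factor 2 for the real and imaginary parts,
    and in each of them a factor 2 for the two signs. *)
Lemma sum_modulus_le4 (z : nat -> K) (S : seq nat) (c : R) :
  (forall P : pred nat, modulus (\sum_(n <- S | P n) z n) <= c) ->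
  \sum_(n <- S) modulus (z n) <= 4 * c.
Proof.
move=> h; have -> : 4 * c = 2 * c + 2 * c by lra.
apply: le_trans (_ : \sum_(n <- S) (`|re_part (z n)| + `|im_part (z n)|) <= _).
  apply: ler_sum => n _; have := modulus_le_parts (z n) 0 0.
  rewrite !subr0; apply: le_trans.
  suff -> : of_parts 0 0 = 0 by rewrite subr0.
  by rewrite /of_parts; case: b.
have sumRe P : \sum_(n <- S | P n) re_part (z n) = re_part (\sum_(n <- S | P n) z n).
  by rewrite (big_morph _ re_partD re_part0).
have sumIm P : \sum_(n <- S | P n) im_part (z n) = im_part (\sum_(n <- S | P n) z n).
  by rewrite (big_morph _ im_partD im_part0).
rewrite big_split /=; apply: lerD; apply: sum_norm_le2 => P.
  by rewrite sumRe; apply: le_trans (re_part_le _) (h P).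
by rewrite sumIm; apply: le_trans (im_part_le _) (h P).
Qed.

End Modulus.
#[export] Hint Resolve modulus_ge0 : core.

(** * Finite Hoelder inequality, its extremal vectors, and the norm of l_p *)

Section PowerSums.
Variable R : realType.
Implicit Types (p q : R).

(** Young's inequality applied to the normalized terms a i / A and c i / C; when A
    or C vanishes so does the whole family, which is treated first. *)
Lemma holder_sum (I : Type) (S : seq I) (a c : I -> R) p q (A C : R) :
  0 < p -> 0 < q -> p^-1 + q^-1 = 1 ->
  (forall i, 0 <= a i) -> (forall i, 0 <= c i) -> 0 <= A -> 0 <= C ->
  \sum_(i <- S) a i `^ p <= A `^ p -> \sum_(i <- S) c i `^ q <= C `^ q ->
  \sum_(i <- S) a i * c i <= A * C.
Proof.
move=> p0 q0 pq a0 c0.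
have zero (f : I -> R) (z : R) : 0 < z -> (forall i, 0 <= f i) ->
    \sum_(i <- S) f i `^ z <= 0 `^ z -> forall (g : I -> R),
    \sum_(i <- S) f i * g i = 0.
  move=> z0 f0; rewrite powR0 ?gt_eqF // => fz g.
  elim: S fz => [|i s IH]; rewrite ?big_nil // !big_cons => h.
  have s0 : 0 <= \sum_(j <- s) f j `^ z by apply: sumr_ge0 => *; exact: powR_ge0.
  have i0 : 0 <= f i `^ z by exact: powR_ge0.
  rewrite IH; last by apply: le_trans h; rewrite lerDr.
  have /powR_eq0_eq0 -> : f i `^ z = 0.
    by apply/eqP; rewrite eq_le i0 andbT; apply: le_trans h; rewrite lerDl.
  by rewrite mul0r addr0.
rewrite le_eqVlt => /predU1P[<- _ /(zero _ _ p0 a0)/(_ c) -> _|A0].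
  by rewrite mul0r.
rewrite le_eqVlt => /predU1P[<- _ /(zero _ _ q0 c0)/(_ a)|C0].
  by under eq_bigr do rewrite mulrC; move=> ->; rewrite mulr0.
move=> ha hc; have AC0 : 0 < A * C by rewrite mulr_gt0.
suff : \sum_(i <- S) (a i / A) * (c i / C) <= 1.
  rewrite (eq_bigr (fun i => a i * c i * (A * C)^-1)); last first.
    by move=> i _; rewrite mulf_div.
  by rewrite -mulr_suml ler_pdivrMr // mul1r.
apply: le_trans (_ : \sum_(i <- S) ((a i / A) `^ p / p + (c i / C) `^ q / q) <= _).
  by apply: ler_sum => i _; apply: conjugate_powR; rewrite // divr_ge0 // ltW.
rewrite big_split /= -pq -!mulr_suml.
have powV (f D z : R) : 0 <= f -> 0 < D -> (f / D) `^ z = f `^ z * (D `^ z)^-1.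
  move=> f0 D0; have D0' := ltW D0.
  by rewrite powRM ?invr_ge0 // -(powR_inv1 D0') -powRrM mulN1r powRN.
apply: lerD; apply: ler_piMl; rewrite ?invr_ge0 ?(ltW p0) ?(ltW q0) //.
  under eq_bigr do rewrite powV //.
  by rewrite -mulr_suml ler_pdivrMr ?mul1r // powR_gt0.
under eq_bigr do rewrite powV //.
by rewrite -mulr_suml ler_pdivrMr ?mul1r // powR_gt0.
Qed.

Lemma nneseries_leP (a : nat -> R) (c : R) : (forall k, 0 <= a k) ->
  (\sum_(0 <= k <oo) (a k)%:E <= c%:E)%E <->
  forall N, \sum_(0 <= k < N) a k <= c.
Proof.
move=> a0; split=> h => [N|].
  rewrite -lee_fin -sumEFin; apply: le_trans h.
  by apply: nneseries_lim_ge => *; rewrite lee_fin.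
apply: lime_le; first by apply: is_cvg_nneseries => *; rewrite lee_fin.
by apply: nearW => N; rewrite sumEFin lee_fin.
Qed.

Lemma sum_nat_widen (a : nat -> R) (M N M' N' : nat) :
  (forall k, 0 <= a k) -> (M' <= M)%N -> (N <= N')%N ->
  \sum_(M <= k < N) a k <= \sum_(M' <= k < N') a k.
Proof.
move=> a0 MM NN; have [MN|NM] := leqP M N; last first.
  by rewrite big_geq ?sumr_ge0 // ltnW.
rewrite (@big_cat_nat _ _ _ M M' N') ?(leq_trans MN) //=.
rewrite (@big_cat_nat _ _ _ N M N') //= addrCA lerDl.
by rewrite addr_ge0 // sumr_ge0.
Qed.

End PowerSums.

Section LpNorm.
Variables (R : realType) (b : scalar_kind).
Local Notation K := (scalar_field R b).
Implicit Types (p q : R) (x y : nat -> K).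

Definition psum p x (M N : nat) : R := \sum_(M <= k < N) modulus (x k) `^ p.

Lemma psum_ge0 p x M N : 0 <= psum p x M N.
Proof. by apply: sumr_ge0 => *; exact: powR_ge0. Qed.

Lemma psum_widen p x M N M' N' : (M' <= M)%N -> (N <= N')%N ->
  psum p x M N <= psum p x M' N'.
Proof. by apply: sum_nat_widen => k; exact: powR_ge0. Qed.

Lemma lp_carrierP p x :
  carrier (lp b p) x <-> exists c : R, forall N, psum p x 0 N <= c.
Proof.
have a0 k : 0 <= modulus (x k) `^ p by exact: powR_ge0.
rewrite /=; split=> [h|[c /(nneseries_leP _ a0) h]]; last first.
  by apply: le_lt_trans h _; rewrite ltry.
have : (0 <= \sum_(0 <= k <oo) (modulus (x k) `^ p)%:E)%E.
  by apply: nneseries_ge0 => *; rewrite lee_fin.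
move: h (fun c => (nneseries_leP c a0).1); case: (\sum_(0 <= k <oo) _)%E => //= c _.
by move=> /(_ c (lexx _)) h _; exists c.
Qed.

(** All estimates are made on finite partial sums of p-th powers; the following
    lemma and its neighbours translate them to and from the norm. *)
Lemma lp_norm_leP p x (c : R) : 0 < p -> 0 <= c ->
  (lp_norm p x <= c%:E)%E <-> forall N, psum p x 0 N <= c `^ p.
Proof.
move=> p0 c0; have a0 k : 0 <= modulus (x k) `^ p by exact: powR_ge0.
rewrite -(nneseries_leP _ a0) /lp_norm; set S := (\sum_(0 <= k <oo) _)%E.
have S0 : (0 <= S)%E by apply: nneseries_ge0 => *; rewrite lee_fin.
have pv : p^-1 * p = 1 by rewrite mulVf // gt_eqF.
have pv' : p * p^-1 = 1 by rewrite mulfV // gt_eqF.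
have itv (z : \bar R) : (0 <= z)%E -> z \in `[0%E, +oo%E].
  by move=> z0; rewrite in_itv /= z0 leey.
split=> h.
  rewrite -(poweRe1 S0) -pv poweRrM -poweR_EFin.
  by apply: gt0_ler_poweR; rewrite ?(ltW p0) ?itv ?poweR_ge0.
rewrite -[c%:E]poweRe1 // -pv' poweRrM poweR_EFin.
by apply: gt0_ler_poweR; rewrite ?invr_ge0 ?(ltW p0) ?itv // lee_fin powR_ge0.
Qed.

Lemma lp_norm_ge0 p x : (0 <= lp_norm p x)%E.
Proof. exact: poweR_ge0. Qed.

Lemma lp_norm_eq1 p x : 0 < p -> (forall N, psum p x 0 N <= 1) ->
  (exists N, psum p x 0 N = 1) -> lp_norm p x = 1%E.
Proof.
move=> p0 h [N hN]; apply/eqP; rewrite eq_le; apply/andP; split.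
  by apply/lp_norm_leP => // n; rewrite powR1.
rewrite leNgt; apply/negP; have := lp_norm_ge0 p x.
case E: (lp_norm p x) => [c| |] //; rewrite lee_fin lte_fin => c0 c1.
have := (lp_norm_leP x p0 c0).1; rewrite E => /(_ (lexx _) N).
have : c `^ p < 1 `^ p by apply: gt0_ltr_powR; rewrite ?nnegrE.
by rewrite hN powR1 ltNge => /negP + ?.
Qed.

Lemma psum1 x M N : psum 1 x M N = \sum_(M <= k < N) modulus (x k).
Proof. by apply: eq_bigr => k _; rewrite powRr1. Qed.

Lemma l1_norm_leP x (c : R) : 0 <= c ->
  (lp_norm 1 x <= c%:E)%E <-> forall N, \sum_(0 <= k < N) modulus (x k) <= c.
Proof.
move=> c0; rewrite (lp_norm_leP x ltr01 c0) powRr1 //.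
by split=> h N; rewrite -?psum1 // psum1.
Qed.

Definition pairing (g y : nat -> K) (M N : nat) : K := \sum_(M <= k < N) g k * y k.

Lemma holder_pairing p q g y M N (A C : R) :
  0 < p -> 0 < q -> p^-1 + q^-1 = 1 -> 0 <= A -> 0 <= C ->
  psum p y M N <= A `^ p -> psum q g M N <= C `^ q ->
  modulus (pairing g y M N) <= C * A.
Proof.
move=> p0 q0 pq A0 C0 hy hg; apply: le_trans (modulus_sum _ _ _) _.
under eq_bigr do rewrite modulusM.
by apply: holder_sum hg hy => //; rewrite addrC.
Qed.

(** Hoelder's inequality is attained at y_k = phase of g_k times
    |g_k|^(q-1) / G^(1/p), where G is the sum of the |g_k|^q: since
    (q-1) p = q this vector has norm 1. *)
Lemma extremal_vector p q g M N :
  0 < p -> 0 < q -> p^-1 + q^-1 = 1 -> 0 < psum q g M N ->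
  exists y : nat -> K,
    [/\ forall k, ~~ (M <= k < N)%N -> y k = 0, psum p y M N = 1 &
        modulus (pairing g y M N) = psum q g M N `^ q^-1].
Proof.
move=> p0 q0 pq; set G := psum q g M N => G0.
have qp : (q - 1) * p = q.
  have p1 : p != 0 by rewrite gt_eqF.
  have q1 : q != 0 by rewrite gt_eqF.
  have : (p^-1 + q^-1) * p * q = p * q by rewrite pq mul1r.
  rewrite mulrDl mulVf // mulrDl mul1r mulrAC mulVf // mul1r; lra.
pose w k := sval (cid2 (phase (g k))).
have w1 k : modulus (w k) = 1 by rewrite /w; case: cid2.
have wg k : g k * w k = of_real b (modulus (g k)) by rewrite /w; case: cid2.
pose a k := modulus (g k) `^ (q - 1) / G `^ p^-1.
have Gp : 0 < G `^ p^-1 by rewrite powR_gt0.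
have a0 k : 0 <= a k by rewrite divr_ge0 ?powR_ge0.
exists (fun k => if (M <= k < N)%N then of_real b (a k) * w k else 0).
split=> [k /negbTE -> //||].
  rewrite /psum (eq_big_nat _ _ (F2 := fun k => modulus (g k) `^ q * G^-1)).
    by rewrite -mulr_suml mulfV // gt_eqF.
  move=> k ->; rewrite modulusM w1 mulr1 modulus_of_real // /a.
  rewrite powRM ?powR_ge0 ?invr_ge0 ?powR_ge0 // -powRrM qp; congr (_ * _).
  by rewrite -powRN -powRrM mulNr mulVf ?gt_eqF // powR_inv1 ?ltW.
rewrite /pairing (eq_big_nat _ _
  (F2 := fun k => of_real b (modulus (g k) `^ q * (G `^ p^-1)^-1))); last first.
  move=> k ->; rewrite mulrCA wg -of_realM; congr (of_real _ _).
  rewrite /a -(mulr_powRB1 (modulus_ge0 (g k)) q0).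
  by rewrite mulrC mulrA.
rewrite -(big_morph _ (@of_realD R b) (@of_real0 R b)) modulus_of_real.
  rewrite -mulr_suml -/(psum q g M N) -/G.
  rewrite -[X in X * _]powRr1 ?ltW // -powRN -powRD; last by rewrite (gt_eqF G0) implybT.
  by congr (_ `^ _); lra.
by apply: sumr_ge0 => k _; rewrite mulr_ge0 ?powR_ge0 ?invr_ge0 ?powR_ge0.
Qed.

End LpNorm.

(** * Uniform boundedness by a gliding hump *)

Section GlidingHump.
Variables (R : realType) (b : scalar_kind).
Local Notation K := (scalar_field R b).
Implicit Types (p q : R) (x y : nat -> K).

Definition supported_below (N : nat) y := forall k, (N <= k)%N -> y k = 0.

Lemma psum_cat p y M N N' : (M <= N)%N -> (N <= N')%N ->
  psum p y M N' = psum p y M N + psum p y N N'.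
Proof. by move=> MN NN; rewrite /psum (@big_cat_nat _ _ _ N). Qed.

Lemma psum_supported p y N n : p != 0 -> supported_below N y ->
  psum p y 0 n <= psum p y 0 N.
Proof.
move=> p0 yN; have [nN|/ltnW Nn] := leqP n N; first exact: psum_widen.
rewrite (@psum_cat _ _ _ N) // [X in _ + X]big_nat_cond big1 ?addr0 //.
by move=> k /andP[/andP[/yN -> _] _]; rewrite modulus0 powR0.
Qed.

Lemma supported_lp p y N : p != 0 -> supported_below N y -> carrier (lp b p) y.
Proof.
move=> p0 yN; apply/lp_carrierP; exists (psum p y 0 N) => n.
exact: psum_supported.
Qed.

Lemma eq_psum p x y M N : (forall k, (M <= k < N)%N -> x k = y k) ->
  psum p x M N = psum p y M N.
Proof. by move=> xy; apply: eq_big_nat => k /xy ->. Qed.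

Lemma eq_pairing (g x y : nat -> K) M N : (forall k, (M <= k < N)%N -> x k = y k) ->
  pairing g x M N = pairing g y M N.
Proof. by move=> xy; apply: eq_big_nat => k /xy ->. Qed.

Variables (p q : R) (g : nat -> nat -> K).
Hypotheses (p0 : 0 < p) (q0 : 0 < q) (pq : p^-1 + q^-1 = 1).
Hypothesis g_tri : forall J, supported_below J (g J).
Hypothesis g_bounded : forall y, carrier (lp b p) y ->
  exists c : R, forall J, modulus (pairing (g J) y 0 J) <= c.

(** The k-th coordinate of g J is the value of the J-th functional at the k-th
    unit vector, so each coordinate is bounded in J. *)
Lemma head_bounded N : exists c : R, forall J, psum q (g J) 0 N <= c.
Proof.
have /choice[c hc] k : exists c : R, forall J, modulus (g J k) <= c.
  pose e := (fun i => if i == k then 1 else 0) : nat -> K.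
  have [|c hc] := g_bounded (y := e).
    apply: (@supported_lp p e k.+1); first by rewrite gt_eqF.
    by move=> i ki; rewrite /e gtn_eqF.
  exists c => J; have := hc J; have [kJ|Jk] := ltnP k J; last first.
    by move=> /(le_trans (modulus_ge0 _)); rewrite (g_tri Jk) modulus0.
  suff -> : pairing (g J) e 0 J = g J k by [].
  rewrite /pairing big_mkord (bigD1 (Ordinal kJ)) //= /e eqxx mulr1 big1 ?addr0 //.
  by move=> i /eqP ik; rewrite ifN ?mulr0 //; apply/eqP => ?; apply/ik/val_inj.
exists (\sum_(0 <= k < N) c k `^ q) => J; apply: ler_sum_nat => k _.
apply: ge0_ler_powR (hc k J); rewrite ?nnegrE ?(ltW q0) //.
  exact: modulus_ge0.
exact: le_trans (modulus_ge0 _) (hc k 0%N).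
Qed.

Hypothesis g_unbounded : forall M : R, exists J, M < psum q (g J) 0 J.

(** One step of the construction.  Since the first N coordinates of all g J are
    bounded, some J > N has a large part of g J on [N, J); adding to y a small
    multiple of the extremal vector of that part makes the J-th functional
    large, whatever its value at y is. *)
Lemma hump N y (e B : R) : supported_below N y -> 0 < e ->
  exists (N' : nat) (y' : nat -> K),
    [/\ (N < N')%N, supported_below N' y', forall k, (k < N)%N -> y' k = y k,
        psum p y' N N' <= e & B <= modulus (pairing (g N') y' 0 N')].
Proof.
move=> yN e0; have pN0 : p != 0 by rewrite gt_eqF.
have [c1 h1] := g_bounded (supported_lp pN0 yN).
have [c2 h2] := head_bounded N.
have l0 : 0 < e `^ p^-1 by rewrite powR_gt0.
set l := e `^ p^-1 in l0 *.
(* The multiple l has l^p = e; D is the size of hump that beats both B and the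
   value c1 at y. *)
pose D : R := Num.max 0 ((B + c1) / l).
have D0 : 0 <= D by rewrite le_max lexx.
have c20 : 0 <= c2 by apply: le_trans (h2 0%N); exact: psum_ge0.
have [J hJ] := g_unbounded (c2 + D `^ q).
have NJ : (N < J)%N.
  rewrite ltnNge; apply/negP => JN; move: hJ; apply/negP; rewrite -leNgt.
  apply: le_trans (psum_widen _ _ (leqnn 0) JN) _; apply: le_trans (h2 J) _.
  by rewrite lerDl powR_ge0.
have hD : D `^ q < psum q (g J) N J.
  move: hJ; rewrite (@psum_cat _ _ _ N) // ?(ltnW NJ) //.
  by have := h2 J; lra.
have [|z [zs z1 zg]] := extremal_vector p0 q0 pq (g := g J) (M := N) (N := J).
  by apply: le_lt_trans hD; exact: powR_ge0.
have Dz : D <= modulus (pairing (g J) z N J).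
  rewrite zg -[leLHS]powRr1 // -[X in _ `^ X](mulfV (lt0r_neq0 q0)).
  rewrite powRrM; apply: ge0_ler_powR; rewrite ?nnegrE ?powR_ge0 ?psum_ge0 ?(ltW hD) //.
  by rewrite invr_ge0 ltW.
exists J, (fun k => y k + of_real b l * z k); split=> //.
- move=> k Jk; rewrite yN ?(leq_trans (ltnW NJ)) // zs ?mulr0 ?addr0 //.
  by rewrite [(k < J)%N]ltnNge Jk andbF.
- by move=> k kN; rewrite zs ?mulr0 ?addr0 // leqNgt kN.
- rewrite (@eq_psum _ _ (fun k => of_real b l * z k)); last first.
    by move=> k /andP[Nk _]; rewrite yN // add0r.
  rewrite /psum; under eq_bigr do
    rewrite modulusM modulus_of_real ?powR_ge0 // powRM ?powR_ge0 //.
  rewrite -mulr_sumr -/(psum p z N J) z1 mulr1 -powRrM mulVf // powRr1 //.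
  exact: ltW.
have -> : pairing (g J) (fun k => y k + of_real b l * z k) 0 J =
    pairing (g J) y 0 J + of_real b l * pairing (g J) z N J.
  rewrite /pairing; under eq_bigr do rewrite mulrDr mulrCA.
  rewrite big_split /= -mulr_sumr; congr (_ + _ * _).
  rewrite (@big_cat_nat _ _ _ N) ?(ltnW NJ) //= big_nat_cond big1 ?add0r //.
  by move=> k /andP[/andP[_ kN] _]; rewrite zs ?mulr0 // leqNgt kN.
have := modulusD (pairing (g J) y 0 J + of_real b l * pairing (g J) z N J)
  (- pairing (g J) y 0 J).
rewrite addrAC subrr add0r modulusM modulus_of_real ?(ltW l0) // modulusN.
have : B + c1 <= l * modulus (pairing (g J) z N J).
  apply: le_trans (_ : l * D <= _); last by rewrite ler_wpM2l // ltW.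
  by rewrite mulrC -ler_pdivrMr // le_max lexx orbT.
by have := h1 J; lra.
Qed.

(** The humps have p-th powers summable like 2^-(i+1), so their sum y lies in
    l_p.  Later humps start beyond the support of earlier functionals, hence do
    not change the values already obtained, and these are unbounded at y. *)
Lemma gliding_hump_absurd : False.
Proof.
pose St := (nat * (nat -> K))%type.
pose e (i : nat) : R := 2^-1 ^+ i.+1.
pose good (i : nat) (s s' : St) := supported_below s.1 s.2 ->
  [/\ (s.1 < s'.1)%N, supported_below s'.1 s'.2,
      forall k, (k < s.1)%N -> s'.2 k = s.2 k,
      psum p s'.2 s.1 s'.1 <= e i &
      i%:R <= modulus (pairing (g s'.1) s'.2 0 s'.1)].
have /choice[F hF] (a : nat * St) : exists s', good a.1 a.2 s'.
  case: a => i [N y]; have [yN|yN] := pselect (supported_below N y); last by exists (0%N, y).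
  have ei0 : 0 < e i by rewrite exprn_gt0 // invr_gt0.
  by have [N' [y' h]] := hump i%:R yN ei0; exists (N', y').
pose st := fix st i : St := if i is j.+1 then F (j, st j) else (0%N, fun=> 0).
have st_supp i : supported_below (st i).1 (st i).2.
  by elim: i => [//|i IH]; have [] := hF (i, st i) IH.
have st_step i := hF (i, st i) (st_supp i).
have st_ltn i : ((st i).1 < (st i.+1).1)%N by have [] := st_step i.
have leq_st i : (i <= (st i).1)%N.
  by elim: i => // i IH; apply: leq_ltn_trans (st_ltn i).
have st_mono i j (ij : (i <= j)%N) : ((st i).1 <= (st j).1)%N.
  by apply: (@homo_leq _ (fun i => (st i).1) leq) ij => // [|k]; [exact: leq_trans | exact: ltnW].
have st_agree i j k : (i <= j)%N -> (k < (st i).1)%N -> (st j).2 k = (st i).2 k.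
  move=> ij ki; elim: j ij => [|j IH]; first by rewrite leqn0 => /eqP ->.
  rewrite leq_eqVlt => /predU1P[-> //|ij]; have [_ _ h _ _] := st_step j.
  by rewrite h ?IH //; apply: leq_trans ki (st_mono _ _ _).
(* The vector st i is final below (st i).1, which is at least i, so index k.+1
   is late enough for coordinate k. *)
pose y k := (st k.+1).2 k.
have y_st i k : (k < (st i).1)%N -> y k = (st i).2 k.
  move=> ki; rewrite /y; have [ik|ki'] := leqP i k.+1; first exact: st_agree.
  by rewrite (st_agree k.+1 i) // ltnW.
have st_psum i : psum p (st i).2 0 (st i).1 <= 1 - 2^-1 ^+ i.
  elim: i => [|i IH]; first by rewrite expr0 subrr /psum big_geq.
  rewrite (@psum_cat _ _ _ (st i).1) ?(ltnW (st_ltn i)) //.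
  rewrite (@eq_psum _ _ (st i).2); last by move=> k /andP[_ ki]; exact: st_agree.
  have [_ _ _ + _] := st_step i; move: IH; rewrite /= /e exprS; lra.
have y_lp : carrier (lp b p) y.
  apply/lp_carrierP; exists 1 => N.
  apply: le_trans (psum_widen _ _ (leqnn 0) (leq_st N)) _.
  rewrite (@eq_psum _ _ (st N).2); last by move=> k /andP[_]; exact: y_st.
  by apply: le_trans (st_psum N) _; rewrite gerBl exprn_ge0 // invr_ge0.
have [c hc] := g_bounded y_lp.
have [i ic] : exists i : nat, c < i%:R.
  exists (Num.bound `|c|); apply: le_lt_trans (ler_norm c) _.
  exact: archi_boundP (normr_ge0 c).
have [_ _ _ _] := st_step i; rewrite leNgt => /negP; apply.
apply: le_lt_trans ic; apply: le_trans (hc (st i.+1).1).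
by rewrite (@eq_pairing _ y (st i.+1).2) // => k /andP[_]; exact: y_st.
Qed.

End GlidingHump.

(** The uniform boundedness principle for finitely supported functionals on
    l_p, with the bound expressed as a bound on l_q norms. *)
Lemma uniform_bound (R : realType) (b : scalar_kind) (p q : R)
    (g : nat -> nat -> scalar_field R b) :
  0 < p -> 0 < q -> p^-1 + q^-1 = 1 ->
  (forall J, supported_below J (g J)) ->
  (forall y, carrier (lp b p) y ->
     exists c : R, forall J, modulus (pairing (g J) y 0 J) <= c) ->
  exists2 M : R, 0 <= M & forall J, psum q (g J) 0 J <= M `^ q.
Proof.
move=> p0 q0 pq gt gb; apply: contrapT => noM.
apply: (@gliding_hump_absurd R b p q g p0 q0 pq gt gb) => M.
apply: contrapT => noJ; apply: noM; exists (Num.max 0 M `^ q^-1) => [|J].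
  exact: powR_ge0.
have M0 : 0 <= Num.max 0 M by rewrite le_max lexx.
rewrite -powRrM mulVf ?gt_eqF // powRr1 // le_max; apply/orP; right.
by rewrite leNgt; apply/negP => MJ; apply: noJ; exists J.
Qed.

(** * The inverse of A(r,s,t) B *)

Section Toeplitz.
Variables (R : realType) (b : scalar_kind).
Local Notation K := (scalar_field R b).
Variable s : nat -> K.
Hypothesis s0 : s 0%N != 0.

Definition conv_inverse (n : nat) : K := (- 1) ^+ n * dets s n.

(** Cramer's rule.  The equations say that (c 0, ..., c n) is the first column of
    the inverse of the lower triangular Toeplitz matrix M of s; the cofactor
    giving its last entry is the minor of M without its first row and last
    column, which is the determinant in D_n. *)
Lemma conv_inverse_unique (c : nat -> K) (n : nat) :
  (forall m, (m <= n)%N ->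
    \sum_(0 <= k < m.+1) s (m - k)%N * c k = (m == 0%N)%:R) ->
  c n = conv_inverse n.
Proof.
move=> hc.
pose M := \matrix_(i < n.+1, j < n.+1) (if (j <= i)%N then s (i - j)%N else 0).
have detM : \det M = s 0%N ^+ n.+1.
  rewrite det_trig; last first.
    by apply/is_trig_mxP => i j ij; rewrite mxE leqNgt ij.
  under eq_bigr do rewrite mxE leqnn subnn.
  by rewrite prodr_const card_ord.
pose C : 'cV_n.+1 := \col_i c i.
have MC : M *m C = delta_mx 0 0.
  apply/matrixP => i j; rewrite !mxE ord1 eqxx andbT.
  rewrite (_ : (i == 0) = (i == 0%N :> nat)) // -hc; last by rewrite -ltnS.
  rewrite big_mkord (big_ord_widen n.+1 (fun k => s (i - k)%N * c k)) //.
  rewrite [RHS]big_mkcond; apply: eq_bigr => k _; rewrite !mxE ltnS.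
  by case: ifP => // _; rewrite mul0r.
have : \adj M *m M *m C = \adj M *m delta_mx 0 0 by rewrite -mulmxA MC.
rewrite mul_adj_mx mul_scalar_mx -colE => /matrixP/(_ ord_max 0).
rewrite !mxE /cofactor detM add0n => E.
have H : s 0%N ^- n.+1 * \det (row' 0 (col' ord_max M)) = dets s n.
  have -> : row' 0 (col' ord_max M) =
      \matrix_(i < n, j < n) if (j <= i.+1)%N then s (i.+1 - j)%N else 0.
    by apply/matrixP => i j; rewrite !mxE lift0 lift_max.
  rewrite /dets; case: n {hc M detM C MC E} => [|//].
  by rewrite eqxx det_mx00 mulr1 expr1.
rewrite /conv_inverse -H mulrCA -E mulKf // expf_neq0 //.
Qed.

(** Forward substitution; a finite range of equations is all that the
    identification with [conv_inverse] uses. *)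
Lemma conv_inverse_exists (N : nat) : exists c : nat -> K, forall m, (m < N)%N ->
  \sum_(0 <= k < m.+1) s (m - k)%N * c k = (m == 0%N)%:R.
Proof.
elim: N => [|N [c hc]]; first by exists (fun=> 0).
pose cN := (s 0%N)^-1 * ((N == 0%N)%:R - \sum_(0 <= k < N) s (N - k)%N * c k).
exists (fun k => if k == N then cN else c k) => m; rewrite ltnS leq_eqVlt.
have head k n : (k < n)%N -> (n <= N)%N -> (if k == N then cN else c k) = c k.
  by move=> kn nN; rewrite ltn_eqF // (leq_trans kn).
move=> /predU1P[->|mN].
  rewrite big_nat_recr //= eqxx subnn mulVKf //.
  rewrite (eq_big_nat _ _ (F2 := fun k => s (N - k)%N * c k)) ?subrKC //.
  by move=> k /andP[_ kN]; rewrite (head _ N).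
rewrite -hc //; apply: eq_big_nat => k /andP[_ km].
by rewrite (head _ m.+1).
Qed.

Lemma conv_inverseP (n : nat) :
  \sum_(0 <= k < n.+1) s (n - k)%N * conv_inverse k = (n == 0%N)%:R.
Proof.
have [c hc] := conv_inverse_exists n.+1.
rewrite -hc //; apply: eq_big_nat => k /andP[_ kn]; congr (_ * _).
apply/esym/conv_inverse_unique => m mk.
by apply: hc; apply: leq_trans kn.
Qed.

Lemma sum_nat_triangle (f : nat -> nat -> K) (m n : nat) :
  \sum_(m <= j < n) \sum_(m <= i < j.+1) f i j =
  \sum_(m <= i < n) \sum_(i <= j < n) f i j.
Proof.
transitivity (\sum_(m <= j < n) \sum_(m <= i < n | (i < j.+1)%N) f i j).
  by apply: eq_big_nat => j /andP[_ jn]; rewrite (big_nat_widen _ _ n).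
rewrite (@exchange_big_dep_nat _ _ _ _ _ _ _ _ _ xpredT) //=.
by apply: eq_big_nat => i /andP[mi _]; rewrite [RHS](big_nat_widenl _ m).
Qed.

End Toeplitz.

Lemma toeplitz_term (F : fieldType) (rn ti x c z : F) : rn != 0 -> ti != 0 ->
  x * ti / rn * ti^-1 * (c * z) = rn^-1 * z * (x * c).
Proof. by move=> rn0 ti0; field; apply/andP. Qed.

Section Triangle.
Variables (R : realType) (b : scalar_kind).
Local Notation K := (scalar_field R b).

Lemma sum_nat_all0 (V : nmodType) (f : nat -> V) m n :
  (forall k, (m <= k < n)%N -> f k = 0) -> \sum_(m <= k < n) f k = 0.
Proof.
by move=> f0; rewrite big_nat_cond big1 // => k; rewrite andbT; exact: f0.
Qed.

Lemma series_finite (f : nat -> K) (m : nat) : (forall k, (m <= k)%N -> f k = 0) ->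
  limn (fun N => \sum_(0 <= k < N) f k) = \sum_(0 <= k < m) f k.
Proof.
move=> f0; apply: cvg_lim => //; apply: cvg_near_cst.
near=> N; rewrite (@big_cat_nat _ _ _ m) //=; last by near: N; exact: nbhs_infty_ge.
rewrite [X in _ + X]sum_nat_all0 ?addr0 // => k /andP[/f0].
Unshelve. all: by end_near. Qed.

Variables (r s t : nat -> K) (u v : K).
Hypothesis r_neq0 : forall n, r n != 0.
Hypothesis t_neq0 : forall n, t n != 0.
Hypothesis s0_neq0 : s 0%N != 0.
Hypothesis u_neq0 : u != 0.

Local Notation T := (matrix_product (mxA r s t) (mxB u v)).

(** For i <= j, the entries of the inverse of B(u,v). *)
Definition binv (j i : nat) : K := (- v) ^+ (j - i) / u ^+ (j - i).+1.

(** The inverse of A(r,s,t) B, as the product of the inverse of B and of that of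
    A(r,s,t), whose entry (i,k) is r k * outer_coef s t k i. *)
Definition rst_inv (j k : nat) : K :=
  r k * \sum_(k <= i < j.+1) outer_coef s t k i * binv j i.

Definition preimage_seq (y : nat -> K) (j : nat) : K :=
  \sum_(0 <= k < j.+1) rst_inv j k * y k.

Lemma product_entry n k :
  T n k = \sum_(0 <= i < n.+1) mxA r s t n i * mxB u v i k.
Proof.
by apply: series_finite => i ni; rewrite /mxA leqNgt ni mul0r.
Qed.

Lemma product_lower n k : (n < k)%N -> T n k = 0.
Proof.
move=> nk; rewrite product_entry sum_nat_all0 // => i /andP[_ ni].
by rewrite /mxB !gtn_eqF ?mulr0 //; lia.
Qed.

Lemma transformE (x : nat -> K) n :
  matrix_transform T x n = \sum_(0 <= k < n.+1) T n k * x k.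
Proof.
by apply: series_finite => k nk; rewrite product_lower ?mul0r.
Qed.

Lemma product_diag n : T n n != 0.
Proof.
rewrite product_entry big_nat_recr //= sum_nat_all0; last first.
  move=> i /andP[_ ni].
  by rewrite /mxB gtn_eqF // gtn_eqF ?mulr0 //; lia.
by rewrite add0r /mxA leqnn subnn /mxB eqxx !mulf_neq0 // invr_eq0.
Qed.

Lemma transform_inj (x x' : nat -> K) :
  matrix_transform T x = matrix_transform T x' -> x = x'.
Proof.
move=> E; apply/funext => n; elim/ltn_ind: n => n IH.
have := congr1 (fun f => f n) E; rewrite /= !transformE !big_nat_recr //=.
rewrite (eq_big_nat _ _ (F2 := fun k => T n k * x' k)).
  by move/addrI/mulfI; apply; exact: product_diag.
by move=> k /andP[_ kn]; rewrite IH.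
Qed.

(** Exchanging the two triangular sums exhibits the two successive inversions:
    a convolution, then the inverse of B. *)
Lemma preimage_seqE y j : preimage_seq y j =
  \sum_(0 <= i < j.+1) binv j i *
    ((t i)^-1 * \sum_(0 <= k < i.+1) conv_inverse s (i - k) * (r k * y k)).
Proof.
rewrite /preimage_seq.
under eq_bigr do rewrite /rst_inv mulrAC mulr_sumr.
rewrite -(sum_nat_triangle (fun k i => r k * y k * (outer_coef s t k i * binv j i))).
apply: eq_bigr => i _; rewrite mulrA mulr_sumr; apply: eq_bigr => k _.
rewrite /outer_coef /conv_inverse; ring.
Qed.

Lemma bidiagonal_inverse (w : nat -> K) (i : nat) :
  \sum_(0 <= j < i.+1) mxB u v i j * (\sum_(0 <= k < j.+1) binv j k * w k) = w i.
Proof.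
case: i => [|i]; first by rewrite !big_nat1 /mxB eqxx /binv subnn expr0 expr1 div1r mulVKf.
rewrite big_nat_recr //= big_nat_recr //= sum_nat_all0 ?add0r; last first.
  by move=> j /andP[_ ji]; rewrite /mxB !ltn_eqF ?mul0r //; lia.
rewrite /mxB ltn_eqF // eqxx [in X in _ + u * X]big_nat_recr //= mulrDr addrA.
rewrite /binv subnn expr0 expr1 div1r mulVKf //.
rewrite [X in u * X](_ : _ = (- v / u) *
    \sum_(0 <= k < i.+1) (- v) ^+ (i - k) / u ^+ (i - k).+1 * w k).
  by rewrite mulrA mulrCA mulfV // mulr1 mulNr subrr add0r.
rewrite mulr_sumr; apply: eq_big_nat => k /andP[_ ki].
by rewrite subSn // !exprS !invfM; ring.
Qed.

Lemma preimageK (y : nat -> K) : matrix_transform T (preimage_seq y) = y.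
Proof.
apply/funext => n; rewrite transformE.
set x := preimage_seq y.
pose w i := (t i)^-1 * \sum_(0 <= k < i.+1) conv_inverse s (i - k) * (r k * y k).
transitivity (\sum_(0 <= i < n.+1) mxA r s t n i *
    (\sum_(0 <= k < n.+1) mxB u v i k * x k)).
  under eq_bigr do rewrite product_entry mulr_suml.
  rewrite exchange_big /=; apply: eq_bigr => i _.
  by rewrite mulr_sumr; apply: eq_bigr => k _; rewrite mulrA.
transitivity (\sum_(0 <= i < n.+1) mxA r s t n i * w i).
  apply: eq_big_nat => i /andP[_ ni]; congr (_ * _).
  rewrite (@big_cat_nat _ _ _ i.+1) //= [X in _ + X]sum_nat_all0 ?addr0.
    rewrite -[RHS]bidiagonal_inverse; apply: eq_bigr => k _.
    by rewrite /x preimage_seqE.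
  by move=> k /andP[ik _]; rewrite /mxB !gtn_eqF ?mul0r // ltnW.
transitivity (\sum_(0 <= i < n.+1) \sum_(0 <= k < i.+1)
    (r n)^-1 * (r k * y k) * (s (n - i)%N * conv_inverse s (i - k))).
  apply: eq_big_nat => i /andP[_ ni]; rewrite /mxA -ltnS ni /w.
  rewrite mulrA mulr_sumr; apply: eq_bigr => k _.
  exact: toeplitz_term.
rewrite sum_nat_triangle big_nat_recr //= big_nat1 subnn.
rewrite sum_nat_all0 ?add0r => [|k /andP[_ kn]].
  rewrite /conv_inverse expr0 mul1r /dets eqxx mulfV // mulr1.
  by rewrite mulrA mulVf // mul1r.
rewrite -mulr_sumr.
have -> : \sum_(k <= i < n.+1) s (n - i)%N * conv_inverse s (i - k) = 0.
  have := conv_inverseP s0_neq0 (n - k).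
  rewrite gtn_eqF ?subn_gt0 // => E; apply: etrans _ E.
  rewrite -{1}[k]add0n big_addn subSn ?(ltnW kn) //.
  apply: eq_bigr => i _; rewrite addnK; congr (s _ * _); lia.
by rewrite mulr0.
Qed.

Lemma preimage_of_transform (x : nat -> K) : preimage_seq (matrix_transform T x) = x.
Proof. by apply: transform_inj; rewrite preimageK. Qed.

(** The terms j = k, i = k, k+1 and i >= k+2 of the triangular double sum are the
    three summands in the definition of [tilde]; the last one is a square
    partial sum of the double series. *)
Lemma tilde_partial_sum (A : nat -> nat -> K) n k N : (k.+2 <= N)%N ->
  \sum_(0 <= j < N) A n j * rst_inv j k =
  r k * (A n k / (s 0%N * t k) / u
    + \sum_(k <= i < k.+2)
        outer_coef s t k i * (\sum_(k.+1 <= j < N) inner_term u v A n i j)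
    + \sum_(k.+2 <= i < N)
        outer_coef s t k i * (\sum_(i <= j < N) inner_term u v A n i j)).
Proof.
move=> kN; rewrite (@big_cat_nat _ _ _ k) //=; last by lia.
rewrite sum_nat_all0 ?add0r; last first.
  by move=> j /andP[_ jk]; rewrite /rst_inv big_geq ?mulr0.
under eq_bigr do rewrite /rst_inv mulrCA mulr_sumr.
rewrite -mulr_sumr; congr (_ * _).
rewrite [LHS]big_ltn; last by lia.
rewrite [X in X + _ = _]big_nat1 -addrA; congr (_ + _).
  rewrite /outer_coef /binv subnn /dets eqxx !expr0 expr1 !mul1r !invfM.
  by rewrite -!mulrA.
transitivity (\sum_(k.+1 <= j < N) (\sum_(k <= i < k.+2)
      outer_coef s t k i * inner_term u v A n i j +
    \sum_(k.+2 <= i < j.+1) outer_coef s t k i * inner_term u v A n i j)).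
  apply: eq_big_nat => j /andP[kj _]; rewrite -big_cat_nat //=; last by lia.
  apply: eq_bigr => i _; rewrite /inner_term /binv; ring.
rewrite big_split /=; congr (_ + _).
  by rewrite exchange_big /=; apply: eq_bigr => i _; rewrite mulr_sumr.
rewrite big_ltn // [X in X + _]big_geq // add0r sum_nat_triangle.
by apply: eq_bigr => i _; rewrite mulr_sumr.
Qed.

Lemma cvg_sum_nat (f : nat -> nat -> K) (l : nat -> K) m n :
  (forall i, (m <= i < n)%N -> f i @ \oo --> l i) ->
  (fun N => \sum_(m <= i < n) f i N) @ \oo --> \sum_(m <= i < n) l i.
Proof.
elim: n => [|n IH] fl.
  by under eq_fun do rewrite big_geq //; rewrite big_geq //; exact: cvg_cst.
have [mn|nm] := leqP m n; last first.
  by under eq_fun do rewrite big_geq //; rewrite big_geq //; exact: cvg_cst.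
under eq_fun do rewrite big_nat_recr //=; rewrite big_nat_recr //=.
apply: cvgD; last by apply: fl; rewrite mn leqnn.
by apply: IH => i /andP[mi ni]; apply: fl; rewrite mi ltnW.
Qed.

(** The limit in Pringsheim's sense is both the limit along squares and, because
    the inner series converge, the value of the iterated series. *)
Lemma tilde_is_limit (A : nat -> nat -> K) n k :
  tilde_series_converge s t u v A n k ->
  (fun N => \sum_(0 <= j < N) A n j * rst_inv j k) @ \oo --> tilde r s t u v A n k.
Proof.
case=> c1 c2 c3 /cvg_ex[l cl].
pose P I J := \sum_(k.+2 <= i < I)
  outer_coef s t k i * (\sum_(i <= j < J) inner_term u v A n i j).
pose Q I := \sum_(k.+2 <= i < I)
  outer_coef s t k i * limn (fun J => \sum_(i <= j < J) inner_term u v A n i j).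
have diag : (fun N => P N N) @ \oo --> l.
  have : (fun N : nat => (N, N)) @ \oo --> (\oo, \oo) by exact: cvg_pair.
  by move=> /cvg_comp/(_ cl).
have PQ I : P I @ \oo --> Q I.
  by apply: cvg_sum_nat => i /andP[ki _]; apply: cvgMr; exact: c2.
have Ql : Q @ \oo --> l.
  apply/cvg_modulusP => e e0.
  have /cvg_modulusP/(_ (e / 2)) := cl; rewrite divr_gt0 // => /(_ isT).
  move=> [[S1 S2] /= [[N1 _ h1] [N2 _ h2]] h].
  near=> I; apply: (@le_lt_trans _ _ (e / 2)); last by lra.
  apply: (cvg_modulus_le (f := fun J => P I J - l)).
    by apply: cvgB; [exact: PQ|exact: cvg_cst].
  exists N2 => J NJ; apply/ltW/(h (I, J)); split; [apply: h1|exact: h2].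
  by near: I; exact: nbhs_infty_ge.
rewrite /tilde; apply: (@cvg_trans _ ((fun N => r k * (A n k / (s 0%N * t k) / u
    + \sum_(k <= i < k.+2)
        outer_coef s t k i * (\sum_(k.+1 <= j < N) inner_term u v A n i j)
    + P N N)) @ \oo)).
  apply: near_eq_cvg; near=> N; rewrite tilde_partial_sum //.
  by near: N; exact: nbhs_infty_ge.
apply: cvgMr; apply: cvgD; last first.
  by have /cvg_lim -> : Q @ \oo --> l by [].
apply: cvgD; first exact: cvg_cst.
by apply: cvg_sum_nat => i ki; apply: cvgMr; exact: c1.
Unshelve. all: by end_near. Qed.

End Triangle.

(** * Rows of A as bounded functionals on l_p *)

Lemma lp_tail_small (R : realType) (b : scalar_kind) (p : R)
    (y : nat -> scalar_field R b) (d : R) :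
  carrier (lp b p) y -> 0 < d ->
  exists N0, forall N J, (N0 <= N)%N -> psum p y N J <= d.
Proof.
move=> /lp_carrierP[c hc] d0.
pose su := [set psum p y 0 N | N in [set: nat]].
have su_sup : has_sup su.
  split; first by exists (psum p y 0 0), 0%N.
  by exists c => _ [N _ <-].
have [_ [N0 _ <-] hN0] := sup_adherent d0 su_sup.
exists N0 => N J N0N; have [NJ|JN] := leqP N J; last first.
  by rewrite /psum big_geq ?(ltW d0) // ltnW.
have : psum p y 0 J <= sup su by apply: ub_le_sup su_sup.2 _ _; exists J.
rewrite (@psum_cat _ _ _ _ _ N) //; move: (psum_widen p y (leqnn 0) N0N); lra.
Qed.

(** The row a of a matrix, applied to S y.  Its J-th partial sum is a functional
    supported on the first J coordinates of y, with coefficients g J. *)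
Section RowFunctional.
Variables (R : realType) (b : scalar_kind).
Local Notation K := (scalar_field R b).
Variables (p q : R).
Hypotheses (p0 : 0 < p) (q0 : 0 < q) (pq : p^-1 + q^-1 = 1).
Variables (a : nat -> K) (S : nat -> nat -> K) (tau : nat -> K).
Hypothesis S_lower : forall j k, (j < k)%N -> S j k = 0.
Hypothesis tau_lim : forall k, (fun N => \sum_(0 <= j < N) a j * S j k) @ \oo --> tau k.

Let functional (y : nat -> K) (J : nat) : K :=
  \sum_(0 <= j < J) a j * \sum_(0 <= k < j.+1) S j k * y k.

Hypothesis functional_cvg : forall y, carrier (lp b p) y -> cvgn (functional y).

Let g J k : K := \sum_(0 <= j < J) a j * S j k.

Lemma functionalE y J : functional y J = pairing (g J) y 0 J.
Proof.
rewrite /functional /pairing /g; under [RHS]eq_bigr do rewrite mulr_suml.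
rewrite [RHS]exchange_big; apply: eq_big_nat => j /andP[_ jJ].
rewrite mulr_sumr [RHS](@big_cat_nat _ _ _ j.+1) //= [X in _ + X]sum_nat_all0 ?addr0.
  by apply: eq_bigr => k _; rewrite mulrA.
by move=> k /andP[jk _]; rewrite S_lower // mulr0 mul0r.
Qed.

Lemma g_supported J : supported_below J (g J).
Proof.
move=> k Jk; apply: sum_nat_all0 => j /andP[_ jJ].
by rewrite S_lower ?mulr0 // (leq_trans jJ).
Qed.

Lemma g_uniform_bound : exists2 M : R, 0 <= M & forall J, psum q (g J) 0 J <= M `^ q.
Proof.
apply: (uniform_bound p0 q0 pq g_supported) => y /functional_cvg.
move=> /cvg_modulus_bounded[c hc]; exists c => J.
by rewrite -functionalE.
Qed.

Lemma row_bounded : exists2 M : R, 0 <= M & forall y (C : R), 0 <= C ->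
  (forall N, psum p y 0 N <= C `^ p) -> modulus (limn (functional y)) <= M * C.
Proof.
have [M M0 hM] := g_uniform_bound; exists M => // y C C0 hy.
have ylp : carrier (lp b p) y by apply/lp_carrierP; exists (C `^ p).
apply: (cvg_modulus_le (functional_cvg ylp)); exists 0%N => J _.
by rewrite functionalE; apply: (holder_pairing p0 q0 pq).
Qed.

(** Compare with the partial functionals: beyond N their contribution is at most
    the uniform bound times the norm of the tail of y, and below N their
    coefficients tend to tau. *)
Lemma row_representation y : carrier (lp b p) y ->
  (fun N => pairing tau y 0 N) @ \oo --> limn (functional y).
Proof.
move=> ylp; have [M M0 hM] := g_uniform_bound.
have M1 : 0 < M + 1 by rewrite ltr_wpDl.
apply/cvg_modulusP => e e0.
pose d := e / 2 / (M + 1); have d0 : 0 < d by rewrite !divr_gt0.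
(* Beyond N0 the tails of y have norm at most d, which the uniform bound turns
   into at most e / 2. *)
have [N0 tailN0] := lp_tail_small ylp (powR_gt0 p d0).
exists N0 => // N; rewrite /= => N0N.
apply: (@le_lt_trans _ _ ((M + 1) * d)); last first.
  by rewrite /d mulrC divfK ?gt_eqF //; lra.
rewrite modulusBC; apply: (cvg_modulus_le (f := fun J => functional y J - pairing (g J) y 0 N)).
  apply: cvgB; first exact: functional_cvg.
  apply: cvg_sum_nat => k _; apply: cvgMl; exact: tau_lim.
exists N => J NJ; rewrite functionalE {1}/pairing (@big_cat_nat _ _ _ N) //=.
rewrite addrAC subrr add0r.
apply: (holder_pairing p0 q0 pq); rewrite ?(ltW d0) ?(ltW M1) //; first exact: tailN0.
apply: (@le_trans _ _ (M `^ q)).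
  by apply: le_trans (hM J); exact: psum_widen.
by apply: ge0_ler_powR; rewrite ?nnegrE ?(ltW q0) ?(ltW M1) // lerDl.
Qed.

End RowFunctional.

(** * Finite nets, finite index sets and the suprema over F_m *)

Section Nets.
Variables (R : realType) (b : scalar_kind).
Local Notation K := (scalar_field R b).

Lemma real_net (M e : R) : 0 < e -> exists (N : nat) (c : nat -> R),
  forall x, `|x| <= M -> exists2 i, (i < N)%N & `|x - c i| <= e.
Proof.
move=> e0; exists (Num.truncn ((M + M) / e)).+1, (fun i => i%:R * e - M) => x.
rewrite ler_norml => /andP[Mx xM].
have xM0 : 0 <= (x + M) / e by rewrite divr_ge0 ?(ltW e0) //; lra.
exists (Num.truncn ((x + M) / e)).
  by rewrite ltnS; apply: le_truncn; rewrite ler_wpM2r ?invr_ge0 ?(ltW e0) // lerD2r.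
have /andP[] := truncn_itv xM0.
rewrite ler_pdivlMr // ltr_pdivrMr // -natr1 => h1 h2.
by rewrite ler_norml; apply/andP; split; lra.
Qed.

Lemma scalar_net (M e : R) : 0 < e -> exists (N : nat) (c : nat -> K),
  forall x, modulus x <= M -> exists2 i, (i < N)%N & modulus (x - c i) <= e.
Proof.
move=> e0; have e20 : 0 < e / 2 by rewrite divr_gt0.
have [N [c hc]] := real_net M e20.
exists (N * N)%N, (fun i => of_parts b (c (i %% N)%N) (c (i %/ N)%N)) => x xM.
have [i iN ci] := hc _ (le_trans (re_part_le x) xM).
have [j jN cj] := hc _ (le_trans (im_part_le x) xM).
exists (j * N + i)%N; first by nia.
rewrite modnMDl modn_small // divnMDl ?(leq_ltn_trans _ iN) // divn_small // addn0.
by apply: le_trans (modulus_le_parts _ _ _) _; lra.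
Qed.

(** By induction on the number of coordinates; pairs of indices
    below N1 and N are coded by j * N + i and decoded by division with
    remainder. *)
Lemma box_net (m : nat) (M : nat -> R) (e : R) : 0 < e ->
  exists (N : nat) (c : nat -> nat -> K), (forall i, supported_below m (c i)) /\
  forall z : nat -> K, (forall n, (n < m)%N -> modulus (z n) <= M n) ->
    exists2 i, (i < N)%N & \sum_(0 <= n < m) modulus (z n - c i n) <= e.
Proof.
elim: m e => [|m IH] e e0.
  exists 1%N, (fun _ _ => 0); split=> // z _; exists 0%N => //.
  by rewrite big_geq // ltW.
have e20 : 0 < e / 2 by rewrite divr_gt0.
have [N1 [c1 h1]] := scalar_net (M m) e20.
have [N [c [c_supp h]]] := IH _ e20.
exists (N1 * N)%N, (fun i n => if n == m then c1 (i %/ N)%N else c (i %% N)%N n).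
split=> [i n mn|z hz]; first by rewrite gtn_eqF // c_supp // ltnW.
have [i iN ci] := h z (fun n nm => hz n (ltnW nm)).
have [j jN cj] := h1 _ (hz m (leqnn _)).
exists (j * N + i)%N; first by nia.
rewrite modnMDl modn_small // divnMDl ?(leq_ltn_trans _ iN) // divn_small // addn0.
rewrite big_nat_recr //= eqxx [leRHS](splitr e); apply: lerD => //.
apply: le_trans ci; rewrite le_eqVlt; apply/orP; left; apply/eqP.
by apply: eq_big_nat => n /andP[_ nm]; rewrite ltn_eqF.
Qed.

End Nets.

Section FiniteSets.
Variables (R : realType) (b : scalar_kind).
Local Notation K := (scalar_field R b).

Lemma fset_sum_le (z : nat -> K) m (C : R) F :
  (forall N, \sum_(m.+1 <= n < N) modulus (z n) <= C) -> finite_sets_above m F ->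
  modulus (\sum_(n <- F) z n) <= C.
Proof.
move=> hC [_ Fm]; apply: le_trans (modulus_sum _ _ _) _.
pose N := (\max_(n <- F) n).+1.
apply: le_trans (hC N); rewrite [leRHS](bigID (fun n => n \in F)) /=.
rewrite -[leLHS]addr0; apply: lerD; last by apply: sumr_ge0 => *; exact: modulus_ge0.
rewrite -[leRHS]big_filter le_eqVlt; apply/orP; left; apply/eqP/perm_big.
apply: uniq_perm; rewrite ?fset_uniq ?filter_uniq ?iota_uniq // => n.
rewrite mem_filter mem_index_iota; case: (boolP (n \in F)) => //= nF.
rewrite Fm //= ltnS; apply/esym/(@leq_bigmax_seq _ _ xpredT id) => //.
Qed.

(** Families F must be nonempty to belong to F_m, whence the second alternative. *)
Lemma sum_filter_fset (V : nmodType) (f : nat -> V) m N (P : pred nat) :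
  (exists F, finite_sets_above m F /\
     \sum_(m.+1 <= n < N | P n) f n = \sum_(n <- F) f n) \/
  (forall n, (m < n < N)%N -> ~~ P n).
Proof.
pose F := [fset n in [seq n <- index_iota m.+1 N | P n]]%fset.
have Fin n : (n \in F) = (m < n < N)%N && P n.
  by rewrite !inE mem_filter mem_index_iota andbC.
have [F0|F0] := eqVneq F fset0.
  by right=> n mn; have := Fin n; rewrite F0 inE mn /= => <-.
left; exists F; split; first by split=> // n; rewrite Fin => /andP[/andP[]].
rewrite -big_filter; apply: perm_big; apply: uniq_perm; rewrite ?fset_uniq //.
  by rewrite filter_uniq // iota_uniq.
by move=> n; rewrite Fin mem_filter mem_index_iota andbC.
Qed.

End FiniteSets.

Section SectionSup.
Variables (R : realType) (b : scalar_kind).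
Local Notation K := (scalar_field R b).
Variables (q : R) (tau : nat -> nat -> K).
Hypothesis q0 : 0 < q.
Local Open Scope ereal_scope.

Lemma section_sup_leP m (c : R) : (0 <= c)%R ->
  section_sup q tau m <= c%:E <->
  forall F, finite_sets_above m F ->
    forall N, (psum q (fun k => \sum_(n <- F) tau n k)%R 0 N <= c `^ q)%R.
Proof.
move=> c0; split=> [h F Fm|h].
  apply/(lp_norm_leP _ q0 c0); apply: le_trans h.
  by apply: ereal_sup_ubound; exists F.
by apply: ge_ereal_sup => _ [F Fm <-]; apply/lp_norm_leP => //; exact: h.
Qed.

Lemma section_sup_nonincreasing : nonincreasing_seq (section_sup q tau).
Proof.
move=> m n mn; apply: ereal_sup_le => _ [F [F0 Fn] <-]; exists F => //.
by split=> // k /Fn; apply: leq_ltn_trans.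
Qed.

Lemma section_sup_ge0 m : 0 <= section_sup q tau m.
Proof.
apply: le_trans (lp_norm_ge0 q (fun k => \sum_(n <- [fset m.+1]%fset) tau n k)%R) _.
apply: ereal_sup_ubound; exists [fset m.+1]%fset => //; split.
  by apply/fset0Pn; exists m.+1; rewrite inE.
by move=> n; rewrite inE => /eqP ->.
Qed.

Lemma lim_section_sup :
  limn (section_sup q tau) = ereal_inf (range (section_sup q tau)).
Proof. by apply/cvg_lim/ereal_nonincreasing_cvgn/section_sup_nonincreasing. Qed.

Lemma lim_section_sup_le m : limn (section_sup q tau) <= section_sup q tau m.
Proof. by rewrite lim_section_sup; apply: ereal_inf_lbound; exists m. Qed.

Lemma lim_section_sup_ge0 : 0 <= limn (section_sup q tau).
Proof.
rewrite lim_section_sup; apply: le_ereal_inf_tmp => _ [m _ <-].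
exact: section_sup_ge0.
Qed.

Lemma lim_section_sup_lt x : limn (section_sup q tau) < x ->
  exists m, section_sup q tau m < x.
Proof.
by rewrite lim_section_sup => /ereal_inf_lt[_ [m _ <-]]; exists m.
Qed.

End SectionSup.

(** * Measure of noncompactness and compactness of an operator from l_p to l_1 *)

Lemma ereal_cvg0P (R : realType) (f : nat -> \bar R) : (forall n, (0 <= f n)%E) ->
  f @ \oo --> 0%E <->
  forall e : R, 0 < e -> \forall n \near \oo, (f n <= e%:E)%E.
Proof.
move=> f0; split=> [/fine_cvgP[ffin fcvg] e e0|h].
  move/cvgrPdist_lt: fcvg => /(_ _ e0) fe; near=> n.
  rewrite -[f n]fineK; last by near: n.
  rewrite lee_fin; apply: le_trans (ler_norm _) _.
  by apply: ltW; rewrite -[fine _]subr0 distrC; near: n.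
apply/fine_cvgP; split.
  apply: filterS (h 1 ltr01) => n f1.
  by rewrite ge0_fin_numE // (le_lt_trans f1) // ltry.
apply/cvgrPdist_le => e e0; apply: filterS (h e e0) => n fe.
have fn : f n \is a fin_num by rewrite ge0_fin_numE // (le_lt_trans fe) // ltry.
by rewrite distrC subr0 /= ger0_norm ?fine_ge0 // -lee_fin fineK.
Unshelve. all: by end_near. Qed.

(** From here on only three properties of the operator matter: its coordinates
    are the pairings with the rows tau n, they are bounded on balls, and its
    values lie in l_1. *)
Section Operator.
Variables (R : realType) (b : scalar_kind).
Local Notation K := (scalar_field R b).
Variables (p q : R).
Hypotheses (p0 : 0 < p) (q0 : 0 < q) (pq : p^-1 + q^-1 = 1).
Variables (tau : nat -> nat -> K) (L : (nat -> K) -> nat -> K).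
Hypothesis L_repr : forall y n, carrier (lp b p) y ->
  (fun N => pairing (tau n) y 0 N) @ \oo --> L y n.
Hypothesis L_bounded : forall n, exists2 M : R, 0 <= M &
  forall y (C : R), 0 <= C -> (forall N, psum p y 0 N <= C `^ p) ->
  modulus (L y n) <= M * C.
Hypothesis L_l1 : forall y, carrier (lp b p) y -> carrier (lp b 1) (L y).

Local Notation ell := (limn (section_sup q tau)).
Local Notation sphere := (unit_sphere (lp b p)).

Let bounded_lp y (C : R) : (forall N, psum p y 0 N <= C `^ p) -> carrier (lp b p) y.
Proof. by move=> h; apply/lp_carrierP; exists (C `^ p). Qed.

Lemma sum_pairing (S : seq nat) y N :
  pairing (fun k => \sum_(n <- S) tau n k) y 0 N = \sum_(n <- S) pairing (tau n) y 0 N.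
Proof.
by rewrite exchange_big; apply: eq_bigr => k _; rewrite mulr_suml.
Qed.

Lemma sum_repr (S : seq nat) y : carrier (lp b p) y ->
  (fun N => pairing (fun k => \sum_(n <- S) tau n k) y 0 N) @ \oo -->
  \sum_(n <- S) L y n.
Proof.
move=> ylp; under eq_fun do rewrite sum_pairing.
elim: S => [|n S IH].
  by rewrite big_nil [X in X @ _](_ : _ = fun=> 0);
    [exact: cvg_cst|apply/funext => N; rewrite big_nil].
rewrite big_cons [X in X @ _](_ : _ = fun N => pairing (tau n) y 0 N +
    \sum_(j <- S) pairing (tau j) y 0 N); last first.
  by apply/funext => N; rewrite big_cons.
by apply: cvgD => //; exact: L_repr.
Qed.

(** Every finite sum of coordinates beyond m is at most c * C by Hoelder's
    inequality; [sum_modulus_le4] then bounds the sum of moduli. *)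
Lemma tail_bound m (c C : R) y : 0 <= c -> 0 <= C ->
  (section_sup q tau m <= c%:E)%E -> (forall N, psum p y 0 N <= C `^ p) ->
  forall N, \sum_(m.+1 <= n < N) modulus (L y n) <= 4 * (c * C).
Proof.
move=> c0 C0 /(section_sup_leP _ q0 _ c0) hc hy N; apply: sum_modulus_le4 => P.
have [[F [Fm ->]]|h] := sum_filter_fset (L y) m N P; last first.
  rewrite big_nat_cond big1 ?modulus0 ?mulr_ge0 // => n /andP[/h].
  by case: (P n).
apply: (cvg_modulus_le (sum_repr (bounded_lp hy))); exists 0%N => M _.
by apply: (holder_pairing p0 q0 pq) => //; exact: hc.
Qed.

(** A finite section of some row sum over F already has l_q norm above c; take
    the extremal vector of that section. *)
Lemma exceeding_vector m (c : R) : 0 <= c -> (c%:E < section_sup q tau m)%E ->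
  exists y F, [/\ sphere y, forall N, psum p y 0 N <= 1 `^ p,
    finite_sets_above m F & c < modulus (\sum_(n <- F) L y n)].
Proof.
move=> c0 cS.
have [F [Fm [N hN]]] : exists F, finite_sets_above m F /\
    exists N, c `^ q < psum q (fun k => \sum_(n <- F) tau n k) 0 N.
  apply: contrapT => h; move: cS; apply/negP; rewrite -leNgt.
  apply/section_sup_leP => // F Fm N; rewrite leNgt; apply/negP => hN.
  by apply: h; exists F; split=> //; exists N.
have G0 := le_lt_trans (powR_ge0 c q) hN.
have [y [ys y1 yg]] := extremal_vector p0 q0 pq G0.
have ysupp : supported_below N y by move=> k Nk; apply: ys; rewrite leq0n /= -leqNgt.
have yle n : psum p y 0 n <= 1.
  by rewrite -y1; apply: psum_supported; rewrite ?lt0r_neq0.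
have ylp : carrier (lp b p) y by apply/lp_carrierP; exists 1.
exists y, F; split=> //.
- by split=> //=; apply: lp_norm_eq1 => //; exists N.
- by move=> n; rewrite powR1.
have -> : \sum_(n <- F) L y n = pairing (fun k => \sum_(n <- F) tau n k) y 0 N.
  apply: (cvg_unique _ (sum_repr ylp)) => //; apply: cvg_near_cst.
  exists N => // n /= Nn; rewrite /pairing (@big_cat_nat _ _ _ N) //=.
  by rewrite [X in _ + X]sum_nat_all0 ?addr0 // => k /andP[/ysupp -> _]; rewrite mulr0.
rewrite yg -[ltLHS]powRr1 // -[X in _ `^ X](mulfV (lt0r_neq0 q0)) powRrM.
by apply: gt0_ltr_powR; rewrite ?invr_gt0 ?nnegrE ?powR_ge0 ?psum_ge0.
Qed.

Lemma l1_tails (n : nat) (c : 'I_n.+1 -> nat -> K) (d : R) : 0 < d ->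
  (forall i, carrier (lp b 1) (c i)) ->
  exists m, forall i N, \sum_(m.+1 <= k < N) modulus (c i k) <= d.
Proof.
move=> d0 hc; have /choice[f hf] i := lp_tail_small (hc i) d0.
exists (\max_i f i)%N => i N; rewrite -psum1; apply: hf.
by apply: leq_trans (leqnSn _); exact: leq_bigmax.
Qed.

(** Choose m such that the tails of all centres beyond m are at most d.  A vector
    of the sphere whose sum over F exceeds eps + d would be mapped farther than
    eps from every centre. *)
Theorem lim_section_sup_le_chi : (ell <= chi (lp b 1) (L @` sphere))%E.
Proof.
apply: le_ereal_inf_tmp => _ [eps [eps0 [n [c [rho [cY rho_eps cover]]]]] <-].
apply/lee_addgt0Pr => d d0; have [m hm] := l1_tails d0 cY.
apply: le_trans (lim_section_sup_le _ _ m) _; rewrite leNgt; apply/negP.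
move=> /exceeding_vector[]; first by rewrite addr_ge0 // ltW.
move=> y [F [ys yle Fm]]; apply/negP; rewrite -leNgt.
have [i _ [_ Lyc]] : (\bigcup_(i in [set: 'I_n.+1]) open_ball (lp b 1) (c i) (rho i)) (L y).
  by apply: cover; exists y.
have eps_ge0 : 0 <= eps by rewrite ltW.
have near_c : forall N, \sum_(0 <= k < N) modulus (L y k - c i k) <= eps.
  apply/l1_norm_leP => //; apply: ltW; apply: lt_le_trans Lyc _.
  by rewrite lee_fin ltW.
apply: fset_sum_le Fm => N; apply: le_trans (_ : \sum_(m.+1 <= k < N)
    (modulus (L y k - c i k) + modulus (c i k)) <= _).
  by apply: ler_sum => k _; rewrite -[X in modulus X <= _](subrK (c i k)) modulusD.
rewrite big_split /=; apply: lerD; last exact: hm.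
apply: le_trans (near_c N); apply: sum_nat_widen => // k; exact: modulus_ge0.
Qed.

Lemma tail_bound_exists (x : R) : (ell < x%:E)%E ->
  exists m (c : R), [/\ 0 <= c, c < x & (section_sup q tau m <= c%:E)%E].
Proof.
move=> /lim_section_sup_lt[m]; have := section_sup_ge0 q tau m.
case E : (section_sup q tau m) => [c| |] // c0 cx.
by exists m, c; rewrite E.
Qed.

(** Centres are finitely supported: a net of the box containing the first m+1
    coordinates.  The remaining coordinates contribute at most 4 c, with c close
    to the limit. *)
Theorem chi_le_lim_section_sup : (chi (lp b 1) (L @` sphere) <= 4%:E * ell)%E.
Proof.
have ell0 : (0 <= ell)%E by exact: lim_section_sup_ge0.
case E : ell ell0 => [l| |] // l0; last by rewrite mulry gtr0_sg // mul1e leey.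
apply/lee_addgt0Pr => e e0; rewrite -EFinM -EFinD.
have [m [c [c0 cl hc]]] : exists m (c : R),
    [/\ 0 <= c, c < l + e / 8 & (section_sup q tau m <= c%:E)%E].
  by apply: tail_bound_exists; rewrite E lte_fin ltrDl divr_gt0.
have /choice[M hM] n : exists M : R, forall y, (forall N, psum p y 0 N <= 1 `^ p) ->
    modulus (L y n) <= M.
  have [M _ hM] := L_bounded n; exists (M * 1) => y hy; exact: hM.
have e80 : 0 < e / 8 by rewrite divr_gt0.
have [N [cc [cc_supp net]]] := box_net b m.+1 M e80.
apply: ereal_inf_lbound; exists (4 * l + e) => //.
split; first by rewrite ltr_wpDl // mulr_ge0.
exists N, (fun i => cc i), (fun=> 4 * c + e / 4); split=> [i|i|].
- by apply: supported_lp (cc_supp i); rewrite oner_eq0.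
- lra.
move=> _ [y [ylp /= y1] <-].
have yle : forall n, psum p y 0 n <= 1 `^ p by apply/lp_norm_leP; rewrite // y1.
have [i iN hi] := net (L y) (fun n _ => hM n y yle).
exists (Ordinal (leqW iN)) => //; split; first exact: L_l1.
apply: (@le_lt_trans _ _ (4 * c + e / 8)%:E); last by rewrite lte_fin; lra.
apply/l1_norm_leP => [|n]; first by rewrite addr_ge0 ?mulr_ge0 // ltW.
apply: (@le_trans _ _ (\sum_(0 <= k < maxn m.+1 n) modulus (L y k - cc i k))).
  by apply: sum_nat_widen => //; exact: leq_maxr.
rewrite (@big_cat_nat _ _ _ m.+1) ?leq_maxl //= addrC; apply: lerD => //.
rewrite (eq_big_nat _ _ (F2 := fun k => modulus (L y k))).
  by have := tail_bound c0 ler01 hc yle (maxn m.+1 n); rewrite mulr1.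
by move=> k /andP[mk _]; rewrite cc_supp // subr0.
Qed.

(** Sequential compactness of L on l_p itself, to which that of the original
    operator reduces through the isometry with l_p(r,s,t;B). *)
Definition compact_on_lp := forall y : nat -> nat -> K,
  (forall i, carrier (lp b p) (y i)) ->
  (exists M : R, forall i, (lp_norm p (y i) <= M%:E)%E) ->
  exists phi : nat -> nat, {homo phi : i j / (i < j)%N} /\
  exists z : nat -> K, carrier (lp b 1) z /\
    (fun i => lp_norm 1 (fun k => L (y (phi i)) k - z k)) @ \oo --> 0%E.

(** If the limit exceeds e > 0, there are y_m on the sphere and F_m beyond m with
    |sum_(n in F_m) L y_m n| > e.  Along a subsequence L y_m tends to some z in
    l_1, so these sums would be at most e/2 plus a tail of z. *)
Theorem compact_lim_section_sup0 : compact_on_lp -> ell = 0%E.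
Proof.
move=> cpt; apply/eqP; rewrite eq_le lim_section_sup_ge0 // andbT leNgt.
apply/negP => ell_gt0.
have [e e0 he] : exists2 e : R, 0 < e & (e%:E < ell)%E.
  case: ell ell_gt0 => [l| |] // l0; last by exists 1; rewrite // ltry.
  by exists (l / 2); rewrite ?divr_gt0 // lte_fin; move: l0; rewrite lte_fin; lra.
have /choice[y /choice[F hyF]] m := exceeding_vector (m := m) (ltW e0)
  (lt_le_trans he (lim_section_sup_le _ _ m)).
have y_lp i : carrier (lp b p) (y i) by have [[]] := hyF i.
have [|phi [phi_homo [z [zl zlim]]]] := cpt y y_lp.
  by exists 1 => i; have [[_ /= ->] _ _ _] := hyF i.
have phi_ge i : (i <= phi i)%N.
  by elim: i => // i IH; apply: leq_ltn_trans IH (phi_homo _ _ _).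
have e20 : 0 < e / 2 by rewrite divr_gt0.
have [m0 hm0] := lp_tail_small zl e20.
have [i im0 hi] : exists2 i, (m0 <= i)%N &
    (lp_norm 1 (fun k => L (y (phi i)) k - z k)%R <= (e / 2)%:E)%E.
  have [N _ hN] : \forall i \near \oo,
      (lp_norm 1 (fun k => L (y (phi i)) k - z k)%R <= (e / 2)%:E)%E.
    by apply: (ereal_cvg0P _).1 zlim _ e20 => j; exact: lp_norm_ge0.
  by exists (maxn m0 N); [exact: leq_maxl|apply: hN; exact: leq_maxr].
have [_ _ Fm] := hyF (phi i); apply/negP; rewrite -leNgt.
have {}hi := (l1_norm_leP _ (ltW e20)).1 hi.
rewrite (splitr e); apply: fset_sum_le Fm => N.
apply: le_trans (_ : \sum_((phi i).+1 <= k < N)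
    (modulus (L (y (phi i)) k - z k) + modulus (z k)) <= _).
  by apply: ler_sum => k _; rewrite -[X in modulus X <= _](subrK (z k)) modulusD.
rewrite big_split /=; apply: lerD; last first.
  by rewrite -psum1; apply: hm0; apply: leq_trans im0 (leqW _).
by apply: le_trans (hi N); apply: sum_nat_widen => // k; exact: modulus_ge0.
Qed.

Lemma bounded_ultra_limit (U : set_system nat) (z : nat -> K) (M : R) :
  UltraFilter U -> (forall i, modulus (z i) <= M) ->
  exists l : K, forall e : R, 0 < e -> U [set i | modulus (z i - l) <= e].
Proof.
move=> UU zM.
have real_limit (x : nat -> R) : (forall i, `|x i| <= M) ->
    exists l : R, forall e, 0 < e -> U [set i | `|x i - l| <= e].
  move=> xM; have [|l [_ l_cluster]] := @segment_compact R (- M) M (x @ U) _.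
    suff : U (x @^-1` `[- M, M]) by [].
    by apply: filterE => i; rewrite /= in_itv /= -ler_norml.
  exists l => e e0.
  have [//|far] := in_ultra_setVsetC [set i | `|x i - l| <= e] UU.
  have near_l : nbhs l [set c | `|l - c| < e].
    by apply/nbhs_normP; exists e.
  have x_far : (x @ U) [set c | ~ `|c - l| <= e] by exact: far.
  have [c [/= c_far]] := l_cluster _ _ x_far near_l.
  by rewrite distrC => /ltW.
have [c hc] := real_limit _ (fun i => le_trans (re_part_le _) (zM i)).
have [d hd] := real_limit _ (fun i => le_trans (im_part_le _) (zM i)).
exists (of_parts b c d) => e e0; have e20 : 0 < e / 2 by rewrite divr_gt0.
apply: filterS2 (hc _ e20) (hd _ e20) => i /= h1 h2.
by apply: le_trans (modulus_le_parts _ _ _) _; lra.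
Qed.

(** An ultrafilter finer than the filter at infinity replaces the diagonal
    extraction: all coordinates converge along it at once, and each of its sets
    contains arbitrarily large indices. *)
Theorem lim_section_sup0_compact : ell = 0%E -> compact_on_lp.
Proof.
move=> ell0 y y_lp [M hM].
have M0 : 0 <= M by have := le_trans (lp_norm_ge0 p (y 0%N)) (hM 0%N); rewrite lee_fin.
have {}hM i : forall N, psum p (y i) 0 N <= M `^ p by exact/lp_norm_leP.
pose z i := L (y i).
have [U [UU U_oo]] := @ultraFilterLemma nat \oo _.
have /choice[l hl] n : exists l : K, forall e : R, 0 < e ->
    U [set i | modulus (z i n - l) <= e].
  have [C C0 hC] := L_bounded n.
  by apply: (@bounded_ultra_limit _ _ (C * M)) => i; exact: hC.
have head (N : nat) (e : R) : 0 < e ->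
    U [set i | \sum_(0 <= n < N) modulus (z i n - l n) <= e].
  elim: N e => [|N IH] e e0; first by apply: filterE => i; rewrite /= big_geq // ltW.
  have e20 : 0 < e / 2 by rewrite divr_gt0.
  apply: filterS2 (IH _ e20) (hl N _ e20) => i /= h1 h2.
  by rewrite big_nat_recr //=; lra.
(* Budget for e = 4 d with d = e / 4: the head costs d, the tail of z i costs
   d, and the tail of l, a limit of such tails, is allowed 2 d. *)
have close (e : R) : 0 < e ->
    U [set i | forall N, \sum_(0 <= n < N) modulus (z i n - l n) <= e].
  move=> e0; pose d := e / 4; have d0 : 0 < d by rewrite divr_gt0.
  have M1 : 0 < M + 1 by rewrite ltr_wpDl.
  have [m [c [c0 cd hc]]] := @tail_bound_exists (d / 4 / (M + 1))
    ltac:(by rewrite ell0 lte_fin !divr_gt0).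
  have tail_z i N : \sum_(m.+1 <= n < N) modulus (z i n) <= d.
    apply: le_trans (tail_bound c0 M0 hc (hM i) N) _.
    rewrite mulrC -ler_pdivlMr //; apply: le_trans (_ : c * (M + 1) <= _).
      by rewrite ler_wpM2l // lerDl.
    by rewrite -ler_pdivlMr // ltW.
  have tail_l N : \sum_(m.+1 <= n < N) modulus (l n) <= 2 * d.
    have [i hi] := filter_ex (head N d d0).
    apply: le_trans (_ : \sum_(m.+1 <= n < N)
        (modulus (z i n) + modulus (z i n - l n)) <= _).
      apply: ler_sum => n _; rewrite modulusBC.
      by rewrite -[X in modulus X <= _](subrKC (z i n)) modulusD.
    rewrite big_split mulr2n mulrDl mul1r; apply: lerD => //.
    by apply: le_trans hi; apply: sum_nat_widen => // n; exact: modulus_ge0.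
  apply: filterS (head m.+1 d d0) => i /= hi N.
  apply: (@le_trans _ _ (\sum_(0 <= k < maxn m.+1 N) modulus (z i k - l k))).
    by apply: sum_nat_widen => //; exact: leq_maxr.
  rewrite (@big_cat_nat _ _ _ m.+1) ?leq_maxl //=.
  have -> : e = d + (d + 2 * d) by rewrite /d; lra.
  apply: lerD => //; apply: le_trans (_ : \sum_(m.+1 <= k < maxn m.+1 N)
    (modulus (z i k) + modulus (l k)) <= _).
    by apply: ler_sum => k _; rewrite -(modulusN (l k)) modulusD.
  by rewrite big_split; apply: lerD.
have /choice[f hf] (a : nat * nat) : exists i, (a.1 < i)%N /\
    forall N, \sum_(0 <= n < N) modulus (z i n - l n) <= a.2.+1%:R^-1.
  have /filter_ex[i [ai hi]] : U ([set i | (a.1 < i)%N] `&`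
      [set i | forall N, \sum_(0 <= n < N) modulus (z i n - l n) <= a.2.+1%:R^-1]).
    apply: filterI; first by apply: U_oo; exact: nbhs_infty_gt.
    by apply: close; rewrite invr_gt0.
  by exists i.
(* f (j, k) is an index above j whose value is within 1 / (k + 1) of l. *)
pose phi := fix phi k := f (if k is j.+1 then phi j else 0%N, k).
have phi_close k : forall N, \sum_(0 <= n < N) modulus (z (phi k) n - l n) <= k.+1%:R^-1.
  by case: k => [|k] /=; [exact: (hf (_, 0%N)).2|exact: (hf (_, k.+1)).2].
exists phi; split.
  by apply: homo_ltn => [? ? ?|k]; [exact: ltn_trans|exact: (hf (_, k.+1)).1].
exists l; split.
  apply/lp_carrierP; have [c hc] := (lp_carrierP _ _).1 (L_l1 (y_lp (phi 0%N))).
  exists (1 + c) => N; rewrite psum1.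
  apply: le_trans (_ : \sum_(0 <= n < N)
      (modulus (z (phi 0%N) n - l n) + modulus (z (phi 0%N) n)) <= _).
    apply: ler_sum => n _; rewrite modulusBC.
    by rewrite -[X in modulus X <= _](subrK (z (phi 0%N) n)) modulusD.
  rewrite big_split; apply: lerD; last by rewrite -psum1; exact: hc.
  by have := phi_close 0%N N; rewrite invr1.
apply/ereal_cvg0P => [i|e e0]; first exact: lp_norm_ge0.
near=> i; apply/l1_norm_leP => [|N]; first exact: ltW.
apply: le_trans (phi_close i N) _; apply: ltW; near: i.
exact: near_infty_natSinv_lt (PosNum e0).
Unshelve. all: by end_near. Qed.

End Operator.

(** * The theorem *)

Theorem theorem5p4 (R : realType) (b : scalar_kind)
    (r s t : nat -> scalar_field R b) (u v : scalar_field R b) (p : R)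
    (A : nat -> nat -> scalar_field R b)
    (r_neq0 : forall n, r n != 0) (t_neq0 : forall n, t n != 0)
    (s0_neq0 : s 0%N != 0) (u_neq0 : u != 0) (v_neq0 : v != 0)
    (p_gt1 : 1 < p)
    (tilde_cvg : forall n k, tilde_series_converge s t u v A n k)
    (A_class : matrix_class (lp_rstB p r s t u v) (lp b 1) A) :
  let X := lp_rstB p r s t u v in
  let Y := lp b (1 : R) in
  let L := matrix_transform A in
  let ell := limn (section_sup (p / (p - 1)) (tilde r s t u v A)) in
  [/\ (ell <= chi_norm X Y L)%E,
      (chi_norm X Y L <= 4%:E * ell)%E &
      compact_operator X Y L <-> ell = 0%E].
Proof.
move=> X Y L ell.
pose q := p / (p - 1); pose tau := tilde r s t u v A.
have p0 : 0 < p by lra.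
have q0 : 0 < q by rewrite divr_gt0 //; lra.
have pq : p^-1 + q^-1 = 1 by rewrite /q invf_div mulrBl mulfV ?mul1r ?subrKC ?gt_eqF.
(* Transport to l_p: LS is the operator y |-> A (S y). *)
pose T := matrix_transform (matrix_product (mxA r s t) (mxB u v)).
pose S := preimage_seq r s t u v.
have TS y : T (S y) = y by exact: preimageK.
have ST x : S (T x) = x by exact: preimage_of_transform.
have S_X y : carrier (lp b p) y -> carrier X (S y) by rewrite /= -/T TS.
have S_lower j k : (j < k)%N -> rst_inv r s t u v j k = 0.
  by move=> jk; rewrite /rst_inv big_geq ?mulr0.
have tau_lim n k : (fun N => \sum_(0 <= j < N) A n j * rst_inv r s t u v j k) @ \oo --> tau n k.
  exact: tilde_is_limit.
have series_cvg n y : carrier (lp b p) y ->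
    cvgn (fun N => \sum_(0 <= k < N) A n k * S y k).
  by move=> /S_X /A_class[].
pose LS y := L (S y).
have L_repr y n : carrier (lp b p) y ->
    (fun N => pairing (tau n) y 0 N) @ \oo --> LS y n.
  exact: (row_representation p0 q0 pq S_lower (tau_lim n) (series_cvg n)).
have L_bounded n : exists2 M : R, 0 <= M &
    forall y (C : R), 0 <= C -> (forall N, psum p y 0 N <= C `^ p) ->
    modulus (LS y n) <= M * C.
  exact: (row_bounded p0 q0 pq S_lower (series_cvg n)).
have L_l1 y : carrier (lp b p) y -> carrier (lp b 1) (LS y).
  by move=> /S_X /A_class[].
have sphereE : L @` unit_sphere X = LS @` unit_sphere (lp b p).
  apply/seteqP; split=> _ [x xS <-]; last first.
    by exists (S x) => //; move: xS; rewrite /unit_sphere /= -/T TS.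
  by exists (T x); rewrite // /LS ST.
have compactE : compact_operator X Y L <-> compact_on_lp p LS.
  split=> cpt x xX xM.
    have [||phi hphi] := cpt (fun i => S (x i)); last by exists phi.
    - by move=> i; exact: S_X.
    - by have [M hM] := xM; exists M => i; rewrite /= -/T TS.
  have [|phi [phi_homo [z [zl zlim]]]] := cpt (fun i => T (x i)) xX; first exact: xM.
  exists phi; split; first exact: phi_homo.
  exists z; split; first exact: zl.
  have -> : (fun i => snorm Y (fun k => L (x (phi i)) k - z k)) =
      (fun i => lp_norm 1 (fun k => LS (T (x (phi i))) k - z k)).
    by apply/funext => i; rewrite /LS ST.
  exact: zlim.
rewrite /chi_norm sphereE; split.
- exact: (lim_section_sup_le_chi p0 q0 pq L_repr).
- exact: (chi_le_lim_section_sup p0 q0 pq L_repr L_bounded L_l1).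
rewrite compactE; split.
- exact: (compact_lim_section_sup0 p0 q0 pq L_repr).
- exact: (lim_section_sup0_compact p0 q0 pq L_repr L_bounded L_l1).
Qed.
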